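(* Let $(\mathsf{X},\mathscr{X})$ be a measurable space and $P$ a Markov kernel on $\mathsf{X}\times\mathscr{X}$ satisfying: (i) $P$ is irreducible and aperiodic with unique invariant probability $\pi$; (ii) there exist a non-empty set $\mathsf{C}\in\mathscr{X}$ and reals $u>1$, $M>0$ such that $\sup_{x\in\mathsf{C}}\mathbb{E}_x[u^{\sigma_{\mathsf{C}}}]\leqslant M$, where $\sigma_{\mathsf{C}}=\inf\{n\geqslant 1: X_n\in\mathsf{C}\}$; (iii) there exist $r\in(0,1)$ and $L\geqslant 1$ such that $\mathrm{d}_{\mathrm{TV}}(\delta_xP^n,\pi)\leqslant Lr^n$ for all $x\in\mathsf{C}$ and all $n\geqslant 0$. Let $n\geqslant 1$, $c=(c_0,\ldots,c_{n-1})\in\mathbb{R}_+^n$ and let $f:\mathsf{X}^n\to\mathbb{R}$ be measurable with $|f(x)-f(y)|\leqslant\sum_{i=0}^{n-1}c_i\mathbf{1}_{\{x_i\neq y_i\}}$ for all $x=(x_0,\ldots,x_{n-1}),y=(y_0,\ldots,y_{n-1})\in\mathsf{X}^n$. Then for all $x\in\mathsf{C}$ and all $t>0$, \[ \mathbb{P}_x\big(f(X_0,\ldots,X_{n-1})-\mathbb{E}_x[f(X_0,\ldots,X_{n-1})]>t\big)\leqslant \exp\Big(-\frac{\beta t^2}{\|c\|^2}\Big), \] where $\|c\|^2=\sum_{i=0}^{n-1}c_i^2$ and \[ \beta=\frac{(1-\max(r,u^{-1/4}))^2}{16L}\Big(\frac{5}{\log u}+4ML\Big)^{-1}. \]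
   Context: $(X_k)_{k\geqslant 0}$ is the canonical process on $\mathsf{X}^{\mathbb{Z}_+}$; for a probability measure $\xi$, $\mathbb{P}_\xi$ is the law under which $(X_k)$ is a Markov chain with kernel $P$ and initial distribution $\xi$, $\mathbb{E}_\xi$ its expectation, and $\mathbb{P}_x=\mathbb{P}_{\delta_x}$, $\mathbb{E}_x=\mathbb{E}_{\delta_x}$ with $\delta_x$ the Dirac mass at $x$. $\mathrm{d}_{\mathrm{TV}}(\mu,\nu)=\sup_{A\in\mathscr{X}}|\mu(A)-\nu(A)|$ is the total variation distance. *)

(* Defs.v *)
From HB Require Import structures.
From mathcomp Require Import all_boot all_order all_algebra.
From mathcomp Require Import all_classical all_reals all_analysis.
Set Implicit Arguments. Unset Strict Implicit. Unset Printing Implicit Defensive.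
Import Order.TTheory GRing.Theory Num.Theory.
Local Open Scope classical_set_scope.
Local Open Scope ring_scope.
Local Open Scope ereal_scope.

Section markov_defs.
Context {d : measure_display} {X : measurableType d} {R : realType}.
Variable P : R.-pker X ~> X.

Fixpoint kiter (n : nat) (x : X) (A : set X) : \bar R :=
  match n with
  | 0%N => (\d_x : set X -> \bar R) A
  | k.+1 => \int[P x]_y kiter k y A
  end.

(* finite-dimensional distributions of the chain: for As = [A_0; ...; A_k],
   fdd As x = P_x(X_0 \in A_0, ..., X_k \in A_k)
            = 1_{A_0}(x) \int P(x,dx_1) 1_{A_1}(x_1) \int ... *)
Fixpoint fdd (As : seq (set X)) (y : X) : \bar R :=
  match As with
  | [::] => 1
  | A :: As' => (\1_A y)%:E * \int[P y]_z fdd As' z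
  end.

Context {dO : measure_display} {O : measurableType dO}.

Definition markov_chain (Pr : probability O R) (Xs : nat -> O -> X) (x : X) :=
  (forall k, measurable_fun [set: O] (Xs k)) /\
  forall As : seq (set X), (forall i, (i < size As)%N -> measurable (nth set0 As i)) ->
    Pr [set w | forall i, (i < size As)%N -> nth set0 As i (Xs i w)] = fdd As x.

(* return time sigma_A = inf {n >= 1 : X_n \in A}; None stands for +infinity *)
Definition sigma_time (Xs : nat -> O -> X) (A : set X) (w : O) : option nat :=
  match pselect (exists n, `[< (0 < n)%N /\ A (Xs n w) >] : bool) with
  | left h => Some (ex_minn h)
  | right _ => None
  end.

Definition pow_sigma (u : R) (Xs : nat -> O -> X) (A : set X) (w : O) : \bar R :=
  match sigma_time Xs A w with
  | Some k => (u ^+ k)%:E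
  | None => +oo
  end.

Definition accessible (Px : X -> probability O R) (Xs : nat -> O -> X) (A : set X) :=
  measurable A /\
  forall x, 0 < Px x [set w | exists k, (0 < k)%N /\ A (Xs k w)].

Definition small_for (C : set X) (m : nat) (mu : set X -> \bar R) :=
  measurable C /\ (0 < m)%N /\
  forall x, C x -> forall A, measurable A -> mu A <= kiter m x A.

Definition small_set (C : set X) :=
  exists m (mu : {measure set X -> \bar R}), mu [set: X] != 0 /\ small_for C m mu.

Definition irreducible (Px : X -> probability O R) (Xs : nat -> O -> X) :=
  exists C, accessible Px Xs C /\ small_set C.

Definition E_set (C : set X) (mu : set X -> \bar R) : set nat :=
  [set k | exists eps : R, (0 < eps)%R /\ small_for C k (fun A => eps%:E * mu A)].

(* aperiodic: the period d(C) = gcd E_C of an accessible (m, eps mu)-small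
   set C with mu(C) > 0 equals 1 (gcd E_C = 1 iff some finite subfamily
   of E_C has gcd 1). *)
Definition aperiodic (Px : X -> probability O R) (Xs : nat -> O -> X) :=
  exists C (mu : {measure set X -> \bar R}) m (eps : R),
    accessible Px Xs C /\ (0 < eps)%R /\ 0 < mu C /\
    small_for C m (fun A => eps%:E * mu A) /\
    exists s : seq nat, (forall k, k \in s -> E_set C mu k) /\
                        foldr gcdn 0%N s = 1%N.

Definition invariant_prob (pi : probability X R) :=
  forall A, measurable A -> \int[pi]_y P y A = pi A.

End markov_defs.

Definition dTV {d : measure_display} {X : measurableType d} {R : realType}
  (mu nu : set X -> \bar R) : \bar R :=
  ereal_sup [set `|mu A - nu A| | A in [set A : set X | measurable A]].

Definition beta_const {R : realType} (u M r L : R) : R :=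
  ((1 - Num.max r (u `^ (- 4^-1))) ^+ 2 / (16 * L) * (5 / ln u + 4 * M * L)^-1)%R.

(* Main.v *)
Require Import Defs.
From HB Require Import structures.
From mathcomp Require Import all_boot all_order all_algebra.
From mathcomp Require Import all_classical all_reals all_analysis.
From mathcomp Require Import measurable_realfun ring lra.
Import Order.TTheory GRing.Theory Num.Theory.
Import numFieldNormedType.Exports.
Local Open Scope classical_set_scope.
Local Open Scope ring_scope.

(* Write [rho = max(r, u^(-1/4))] and [A = 16 M L^2 / (1 - rho)^2]. It is enough
   to show [E_x exp(f - E_x f) <= exp(A ||c||^2)] for every [f] and [x] in [C]:
   Chernoff's bound then gives the constant [1 / (4 A)], which exceeds [beta].
   Coordinates with [c_i > 2 / A] are frozen at a fixed value, which costs
   [2 c_i <= A c_i^2] in the exponent. When all the [c_i] are small, [f - E_x f]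
   is decomposed into martingale increments along the successive visits to [C].
   Between a visit at time [k] and the next one at time [tau], the conditional
   expectation of [f] moves by at most
     [D = sum_(k < i <= tau) c_i + 4 L sum_(i > tau) c_i r^(i - tau)],
   since both conditional laws of [X_i] are compared with [pi]. By
   Cauchy-Schwarz and the smallness of the [c_i], [D^2 exp D] is at most
   [u^(tau - k)] times [16 L^2 / (1 - rho) sum_(i > k) rho^(i - k) c_i^2], and
   [exp v <= 1 + v + v^2 exp |v|] together with the exponential moment of the
   return time bounds the conditional moment generating function of the
   increment; these bounds are then summed over [k]. *)

(** * Bounded measurable functions and normalised positive functionals *)

Section bounded_measurable.
Context {d : measure_display} {T : measurableType d} {R : realType}.
Implicit Types f g : T -> R.

Definition bm f := measurable_fun [set: T] f /\ exists B, forall t, `|f t| <= B.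

Lemma bm_cst a : bm (fun=> a).
Proof. by split; [exact: measurable_cst|exists `|a|]. Qed.

Lemma bmD f g : bm f -> bm g -> bm (fun t => f t + g t).
Proof.
move=> [mf [B fB]] [mg [B' gB]]; split; first exact: measurable_funD.
by exists (B + B') => t; rewrite (le_trans (ler_normD _ _))// lerD.
Qed.

Lemma bmM f g : bm f -> bm g -> bm (fun t => f t * g t).
Proof.
move=> [mf [B fB]] [mg [B' gB]]; split; first exact: measurable_funM.
by exists (B * B') => t; rewrite normrM ler_pM.
Qed.

Lemma bmZ a f : bm f -> bm (fun t => a * f t).
Proof. by move=> ?; apply: bmM => //; exact: bm_cst. Qed.

Lemma bmB f g : bm f -> bm g -> bm (fun t => f t - g t).
Proof.
move=> bf bg; have := bmD _ _ bf (bmZ (-1) _ bg).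
by congr bm; apply/funext => t; rewrite mulN1r.
Qed.

Lemma bm_indic (A : set T) : measurable A -> bm (\1_A : T -> R).
Proof.
move=> mA; split; first exact: measurable_indic.
by exists 1 => t; rewrite indicE ger0_norm; case: (_ \in _).
Qed.

Lemma bm_sum (I : Type) (s : seq I) (F : I -> T -> R) :
  (forall i, bm (F i)) -> bm (fun t => \sum_(i <- s) F i t).
Proof.
move=> bF; elim: s => [|i s ih].
  by under eq_fun do rewrite big_nil; exact: bm_cst.
by under eq_fun do rewrite big_cons; exact: bmD.
Qed.

Lemma bm_expR f : bm f -> bm (fun t => expR (f t)).
Proof.
move=> [mf [B fB]]; split; first exact: measurableT_comp.
exists (expR B) => t; rewrite ger0_norm ?expR_ge0// ler_expR.
by rewrite (le_trans _ (fB t))// ler_norm.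
Qed.

Lemma bm_if (A : set T) f g : measurable A -> bm f -> bm g ->
  bm (fun t => if t \in A then f t else g t).
Proof.
move=> mA bf bg.
have := bmD _ _ (bmM _ _ (bm_indic A mA) bf)
                (bmM _ _ (bm_indic _ (measurableC mA)) bg).
congr bm; apply/funext => t; rewrite !indicE in_setC.
by case: (t \in A); rewrite /= ?mul1r ?mul0r ?addr0 ?add0r.
Qed.

End bounded_measurable.

Lemma bm_comp d d' (T : measurableType d) (T' : measurableType d')
    (R : realType) (f : T' -> R) (h : T -> T') :
  bm f -> measurable_fun [set: T] h -> bm (fun t => f (h t)).
Proof.
move=> [mf [B fB]] mh; split; first exact: measurableT_comp.
by exists B => t.
Qed.

Section mean.
Context {d : measure_display} {T : measurableType d} {R : realType}.

(** An abstract expectation on bounded measurable functions: [mean_cvg] is bounded convergence and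
    stands for sigma-additivity. Integrals, kernels and conditional expectations are all handled
    through this interface. *)
Record mean (Lam : (T -> R) -> R) : Prop := Mean {
  mean_cst : forall a, Lam (fun=> a) = a;
  meanD : forall f g, bm f -> bm g ->
    Lam (fun t => f t + g t) = Lam f + Lam g;
  meanZ : forall a f, bm f -> Lam (fun t => a * f t) = a * Lam f;
  mean_le : forall f g, bm f -> bm g -> (forall t, f t <= g t) ->
    Lam f <= Lam g;
  mean_cvg : forall (h : nat -> T -> R) g B, (forall n, bm (h n)) -> bm g ->
    (forall n t, `|h n t| <= B) -> (forall t, h n t @[n --> \oo] --> g t) ->
    Lam (h n) @[n --> \oo] --> Lam g }.

Variable Lam : (T -> R) -> R.
Hypothesis mLam : mean Lam.

Lemma meanB f g : bm f -> bm g -> Lam (fun t => f t - g t) = Lam f - Lam g.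
Proof.
move=> bf bg; rewrite -mulN1r -meanZ// -meanD//; last exact: bmZ.
by congr Lam; apply/funext => t; rewrite mulN1r.
Qed.

Lemma mean_sum (I : Type) (s : seq I) (F : I -> T -> R) :
  (forall i, bm (F i)) ->
  Lam (fun t => \sum_(i <- s) F i t) = \sum_(i <- s) Lam (F i).
Proof.
move=> bF; elim: s => [|i s ih].
  by rewrite big_nil; under eq_fun do rewrite big_nil; rewrite mean_cst.
rewrite big_cons -ih -meanD//; last exact: bm_sum.
by congr Lam; apply/funext => t; rewrite big_cons.
Qed.

Lemma mean_norm f B : bm f -> (forall t, `|f t| <= B) -> `|Lam f| <= B.
Proof.
move=> bf fB; rewrite ler_norml -[X in X <= _](mean_cst _ mLam).
rewrite -[X in _ && (_ <= X)](mean_cst _ mLam).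
by apply/andP; split; apply: mean_le => //; try exact: bm_cst;
  move=> t; have := fB t; rewrite ler_norml => /andP[].
Qed.

End mean.

(** The sum counts the naturals below both [a] and [N], so it is the minimum of [N] and the ceiling
    of [a]. *)
Lemma sum_lt_nat (R : realType) (a : R) N : 0 <= a ->
  (Num.min a N%:R : R) <= \sum_(l < N) (l%:R < a)%R%:R <= a + 1.
Proof.
move=> a0; elim: N => [|N /andP[ih1 ih2]].
  by rewrite big_ord0 ge_min lexx orbT/= ler_wpDr.
rewrite big_ord_recr/=; have [Na|aN] := ltP N%:R a.
  have S : \sum_(l < N) (l%:R < a)%R%:R = N%:R :> R.
    rewrite (eq_bigr (fun=> 1)) ?sumr_const ?card_ord// => l _.
    by rewrite (lt_trans _ Na)// ltr_nat.
  by rewrite S ge_min -natr1 lexx orbT/= lerD2r ltW.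
by move: ih1; rewrite addr0 ih2 !ge_min => /orP[->//|/(le_trans aN) ->].
Qed.

Section mean_dist.
Context {d : measure_display} {T : measurableType d} {R : realType}.
Variables (L1 L2 : (T -> R) -> R) (m1 : mean L1) (m2 : mean L2) (D : R).
Hypothesis H : forall A, measurable A -> `|L1 (\1_A) - L2 (\1_A)| <= D.

(* Discretised layer cake: [g] is within [1 / N] of the average of the
   indicators of [g > l / N], [l < N]. *)
Let mean_dist01 (g : T -> R) : bm g -> (forall t, 0 <= g t <= 1) ->
  `|L1 g - L2 g| <= D.
Proof.
move=> bg g01; apply/ler_addgt0Pr => e e0.
have [N N0 Ne] : exists2 N : nat, (0 < N)%N & N%:R^-1 < e.
  exists (Num.truncn e^-1).+1 => //.
  by rewrite invf_plt ?posrE// ?ltr0n// truncnS_gt// ltW// invr_gt0.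
have N0' : 0 < N%:R :> R by rewrite ltr0n.
pose A l := [set t | l%:R < N%:R * g t].
have mA l : measurable (A l).
  rewrite -[A l]setTI; apply: measurable_fun_ltr => //.
  exact: (bmZ _ _ bg).1.
pose G (t : T) : R := \sum_(l < N) N%:R^-1 * \1_(A l) t.
have bG : bm G by apply: bm_sum => l; exact/bmZ/bm_indic.
have GE t : G t = N%:R^-1 * \sum_(l < N) (l%:R < N%:R * g t)%R%:R.
  rewrite mulr_sumr; apply: eq_bigr => l _; rewrite indicE; congr (_ * _%:R).
  by congr nat_of_bool; apply/idP/idP; rewrite inE.
have gG t : g t <= G t <= g t + N%:R^-1.
  have /andP[g0 g1] := g01 t.
  have /andP[] := sum_lt_nat _ (N%:R * g t) N (mulr_ge0 (ltW N0') g0).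
  rewrite min_l ?ler_piMr ?ler0n// GE => h1 h2.
  by rewrite ler_pdivlMl// h1 ler_pdivrMl// mulrDr divff ?gt_eqF.
have GD : `|L1 G - L2 G| <= D.
  rewrite !mean_sum//; try by move=> l; exact/bmZ/bm_indic.
  rewrite -sumrB (le_trans (ler_norm_sum _ _ _))//.
  have -> : D = \sum_(l < N) N%:R^-1 * D.
    by rewrite sumr_const card_ord -[RHS]mulr_natl mulVKf ?gt_eqF//.
  apply: ler_sum => l _; rewrite !meanZ//; try exact: bm_indic.
  by rewrite -mulrBr normrM ger0_norm ?invr_ge0 ?ler0n// ler_wpM2l ?invr_ge0// H.
have bgN : bm (fun t => g t + N%:R^-1) by apply: bmD => //; exact: bm_cst.
have LG (L0 : (T -> R) -> R) : mean L0 -> L0 g <= L0 G <= L0 g + N%:R^-1.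
  move=> m0; apply/andP; split.
    by apply: mean_le => // t; have /andP[] := gG t.
  rewrite -[X in _ + X](mean_cst _ m0) -meanD//; last exact: bm_cst.
  by apply: mean_le => // t; have /andP[] := gG t.
have := LG _ m1; have := LG _ m2; move: GD; rewrite !ler_norml; lra.
Qed.

(** The map [(g + c) / (2 c)] brings [g] into the unit interval, where the distance is at most [D];
    undoing it multiplies by [2 c]. *)
Lemma mean_dist (g : T -> R) c : 0 <= c -> measurable_fun [set: T] g ->
  (forall t, `|g t| <= c) -> `|L1 g - L2 g| <= 2 * c * D.
Proof.
move=> c_ge0 mg gc.
have bg : bm g by split => //; exists c.
have [c0|c0] := ltP 0 c; last first.
  have g0 : g = fun=> 0.
    apply/funext => t; apply/eqP; rewrite -normr_le0.
    exact: le_trans (gc t) c0.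
  have c00 : c = 0 by apply/eqP; rewrite eq_le c0.
  by rewrite g0 !mean_cst// subrr normr0 c00 mulr0 mul0r.
have c2 : 0 < 2 * c by rewrite mulr_gt0.
pose h (t : T) : R := (2 * c)^-1 * (g t + c).
have bgc : bm (fun t => g t + c) by apply: bmD => //; exact: bm_cst.
have bh : bm h by exact: bmZ.
have h01 t : 0 <= h t <= 1.
  have := gc t; rewrite ler_norml => gct.
  by rewrite mulr_ge0 ?invr_ge0 ?(ltW c2)//= ?ler_pdivrMl//; lra.
have gE : g = fun t => 2 * c * h t + (- c).
  by apply/funext => t; rewrite /h mulrA divff ?gt_eqF// mul1r addrK.
have E L0 : mean L0 -> L0 g = 2 * c * L0 h - c.
  move=> m0; rewrite [in LHS]gE meanD ?meanZ// ?mean_cst//; last exact: bm_cst.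
  exact: bmZ.
rewrite !E// opprB addrACA addrA addrK -mulrBr normrM (ger0_norm (ltW c2)).
by rewrite ler_pM2l// mean_dist01.
Qed.

End mean_dist.

Section mean_integral.
Context {d : measure_display} {T : measurableType d} {R : realType}.
Variable mu : {measure set T -> \bar R}.
Hypothesis mu1 : mu [set: T] = 1%E.

Lemma bm_integrable (f : T -> R) : bm f -> mu.-integrable [set: T] (EFin \o f).
Proof.
move=> [mf [B fB]]; apply: measurable_bounded_integrable => //.
  by rewrite mu1 ltry.
exists B; split; first exact: num_real.
by move=> x Bx t _; apply: le_trans (fB t) _; exact: ltW.
Qed.

Lemma mean_Rintegral : mean (fun g => \int[mu]_t g t).
Proof.
split=> [a|f g bf bg|a f bf|f g bf bg fg|h g B bh bg hB hg].
- by rewrite Rintegral_cst// mu1/= mulr1.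
- by rewrite RintegralD//; exact: bm_integrable.
- by rewrite RintegralZl//; exact: bm_integrable.
- by apply: le_Rintegral => //; exact: bm_integrable.
- apply: fine_cvg; rewrite fineK; last exact/integrable_fin_num/bm_integrable.
  have [] // := @dominated_convergence _ _ _ mu setT measurableT
    (fun n t => (h n t)%:E) (fun t => (g t)%:E) (cst B%:E).
  + by move=> n; apply/measurable_EFinP; case: (bh n).
  + by apply/measurable_EFinP; case: bg.
  + by apply/aeW => t _; apply/cvg_EFin; [exact: nearW|exact: hg].
  + by apply: (@bm_integrable (fun=> B)); exact: bm_cst.
  + by apply/aeW => t n _ /=; rewrite lee_fin.
Qed.

End mean_integral.

Lemma mean_comp d d' (T : measurableType d) (T' : measurableType d')
    (R : realType) (Lam : (T -> R) -> R) (h : T -> T') :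
  mean Lam -> measurable_fun [set: T] h ->
  mean (fun g => Lam (fun t => g (h t))).
Proof.
move=> mL mh; have bh g : bm g -> bm (fun t => g (h t)) by move/bm_comp; exact.
split=> [a|f g bf bg|a f bf|f g bf bg fg|k g B bk bg kB kg].
- exact: mean_cst.
- by rewrite (meanD _ mL)//; exact: bh.
- by rewrite (meanZ _ mL)//; exact: bh.
- by apply: (mean_le _ mL) => //; exact: bh.
- by apply: (mean_cvg _ mL _ _ B) => //; [move=> n; exact: bh|exact: bh].
Qed.

(** * Markov kernels as operators on bounded functions *)

Section bker.
Context {d d' : measure_display} {Y : measurableType d} {T : measurableType d'}.
Context {R : realType}.

Definition bker (K : Y -> (T -> R) -> R) :=
  (forall y, mean (K y)) /\ forall g, bm g -> bm (fun y => K y g).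

Lemma mean_bker (Lam : (Y -> R) -> R) K : mean Lam -> bker K ->
  mean (fun g => Lam (fun y => K y g)).
Proof.
move=> mL [mK bK].
split=> [a|f g bf bg|a f bf|f g bf bg fg|k g B bk bg kB kg].
- by under eq_fun do rewrite (mean_cst _ (mK _)); exact: mean_cst.
- by under eq_fun do rewrite (meanD _ (mK _))//; rewrite (meanD _ mL)//; exact: bK.
- by under eq_fun do rewrite (meanZ _ (mK _))//; rewrite (meanZ _ mL)//; exact: bK.
- apply: (mean_le _ mL); [exact: bK|exact: bK|move=> y].
  exact: (mean_le _ (mK _)).
- apply: (mean_cvg _ mL _ _ B); [by move=> n; exact: bK|exact: bK| |].
    by move=> n y; exact: (mean_norm _ (mK y)).
  by move=> y; exact: (mean_cvg _ (mK y) _ _ B).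
Qed.

Variable k : R.-pker Y ~> T.

Lemma mean_ker y : mean (fun g => \int[k y]_t g t).
Proof. by apply: mean_Rintegral; exact: prob_kernel. Qed.

Lemma bm_ker (G : Y * T -> R) : bm G -> bm (fun y => \int[k y]_t G (y, t)).
Proof.
move=> bG; have [mG [B GB]] := bG.
have bGy y : bm (fun t => G (y, t)).
  by apply: bm_comp bG _; exact: measurable_pair1.
split; last by exists B => y; apply: (mean_norm _ (mean_ker y)).
(* Measurability of the parametric integral is obtained for a nonnegative integrand, hence the shift
   of [G] by its bound [B]. *)
have mI : measurable_fun [set: Y] (fun y => \int[k y]_t (G (y, t) + B)%:E)%E.
  apply: (measurable_fun_integral_finite_kernel
    (fun z => (G z + B)%:E) k) => [z|].
    by rewrite lee_fin -lerBlDr sub0r; have := GB z; rewrite ler_norml => /andP[].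
  by apply/measurable_EFinP; apply: measurable_funD.
rewrite [X in measurable_fun _ X](_ : _ = fun y =>
    fine (\int[k y]_t (G (y, t) + B)%:E)%E - B); last first.
  apply/funext => y.
  have := meanD _ (mean_ker y) _ _ (bGy y) (bm_cst B).
  by rewrite (mean_cst _ (mean_ker y)) /Rintegral => /(canLR (addrK _)).
by apply: measurable_funB => //; apply: measurableT_comp mI.
Qed.

Lemma bker_ker : bker (fun y g => \int[k y]_t g t).
Proof.
split; first exact: mean_ker.
by move=> g bg; apply: (@bm_ker (fun p => g p.2)); exact: bm_comp bg _.
Qed.

End bker.

Section kernel_comp.
Context {d d' d'' : measure_display} {Z : measurableType d''}.
Context {Y : measurableType d} {T : measurableType d'} {R : realType}.
Variables (k : R.-pker Y ~> T) (h : Z -> Y).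
Hypothesis mh : measurable_fun [set: Z] h.

(** The measurability proof is an argument so that the kernel structures below can be attached to
    this term. *)
Definition kcompf of measurable_fun [set: Z] h :=
  fun z : Z => k (h z) : {measure set T -> \bar R}.

HB.instance Definition _ := isKernel.Build _ _ Z T R (kcompf mh)
  (fun U mU => measurableT_comp (measurable_kernel k U mU) mh).

HB.instance Definition _ := Kernel_isProbability.Build _ _ Z T R (kcompf mh)
  (fun z => prob_kernel (h z)).

Lemma bm_kcompf (G : Z * T -> R) : bm G ->
  bm (fun z => \int[k (h z)]_t G (z, t)).
Proof. exact: (@bm_ker _ _ _ _ _ (kcompf mh : R.-pker Z ~> T)). Qed.

End kernel_comp.

(** * Conditional expectations along the chain *)

Section coordinates.
Context {d : measure_display} {X : measurableType d} {N : nat}.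
Local Notation Z := (N.+1.-tuple X).
Implicit Types (z x : Z) (k l : nat) (y : X).

(** Natural indices avoid casts between ordinals. For [k > N], [inord] falls back on coordinate 0,
    whence the bounds [l <= N] below. *)
Definition co z k : X := tnth z (inord k).

Definition upd z k y : Z :=
  [tuple if i == k :> nat then y else tnth z i | i < N.+1].

(** Serves to freeze the beginning of a path when [f] is telescoped over its coordinates, and later
    to freeze the coordinates with a large [c_i]. *)
Definition repl (b : pred nat) z x : Z :=
  [tuple if b i then tnth z i else tnth x i | i < N.+1].

Lemma co_upd z k y l : (l <= N)%N ->
  co (upd z k y) l = if l == k then y else co z l.
Proof. by move=> lN; rewrite /co tnth_mktuple inordK. Qed.

Lemma co_repl b z x l : (l <= N)%N ->
  co (repl b z x) l = if b l then co z l else co x l.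
Proof. by move=> lN; rewrite /co tnth_mktuple inordK. Qed.

Lemma co_inj z x : (forall l, (l <= N)%N -> co z l = co x l) -> z = x.
Proof.
move=> zx; apply: eq_from_tnth => i.
by have := zx i; rewrite -ltnS ltn_ord /co inord_val; exact.
Qed.

Lemma measurable_co k : measurable_fun [set: Z] (co ^~ k).
Proof. exact: measurable_tnth. Qed.

Lemma measurable_co_pair d' (T : measurableType d') k :
  measurable_fun [set: Z * T] (fun p => co p.1 k).
Proof. by apply: (measurableT_comp (measurable_co k)). Qed.

Lemma measurable_upd_pair k :
  measurable_fun [set: Z * X] (fun p => upd p.1 k p.2).
Proof.
apply/measurable_fun_tnthP => i.
have [ik|ik] := boolP (i == k :> nat).
  rewrite (_ : _ \o _ = snd)//.
  by apply/funext => p /=; rewrite tnth_mktuple ik.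
rewrite (_ : _ \o _ = fun p => co p.1 i); first exact: measurable_co_pair.
by apply/funext => p /=; rewrite tnth_mktuple (negbTE ik) /co inord_val.
Qed.

Lemma measurable_upd z k : measurable_fun [set: X] (upd z k).
Proof.
rewrite (_ : upd z k = (fun p : Z * X => upd p.1 k p.2) \o pair z)//.
by apply: measurableT_comp; [exact: measurable_upd_pair|exact: measurable_pair1].
Qed.

Lemma measurable_repl b z : measurable_fun [set: Z] (repl b z).
Proof.
apply/measurable_fun_tnthP => i.
have [bi|bi] := boolP (b i).
  rewrite (_ : _ \o _ = cst (tnth z i)); first exact: measurable_cst.
  by apply/funext => p /=; rewrite tnth_mktuple bi.
rewrite (_ : _ \o _ = @tnth _ _ ^~ i); first exact: measurable_tnth.
by apply/funext => p /=; rewrite tnth_mktuple (negbTE bi).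
Qed.

End coordinates.

Section path_operators.
Context {d : measure_display} {X : measurableType d} {R : realType} {N : nat}.
Variable P : R.-pker X ~> X.
Local Notation Z := (N.+1.-tuple X).
Implicit Types (f g : Z -> R) (z : Z).

(** Conditional expectation over one step. Overwriting coordinate [k + 1] of a full tuple keeps the
    same type at every stage. *)
Definition cstep k g z := \int[P (co z k)]_y g (upd z k.+1 y).

(* [cexp m k f z] is the conditional expectation of [f], a function of the
   coordinates up to [k + m], given the coordinates up to [k]. *)
Fixpoint cexp m k f : Z -> R :=
  if m is m'.+1 then cstep k (cexp m' k.+1 f) else f.

(** This is [P^m g (x)], the real-valued counterpart of [kiter]. *)
Fixpoint kexp m (g : X -> R) (x : X) : R :=
  if m is m'.+1 then \int[P x]_y kexp m' g y else g x.

Lemma bker_cstep k : bker (fun z g => cstep k g z).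
Proof.
split=> [z|g bg].
  exact: mean_comp (mean_ker P (co z k)) (measurable_upd z k.+1).
apply: (@bm_kcompf _ _ _ _ _ _ _ P _ (measurable_co k)
  (fun p : Z * X => g (upd p.1 k.+1 p.2))).
by apply: bm_comp bg _; exact: measurable_upd_pair.
Qed.

Lemma bker_cexp m k : bker (fun z g => cexp m k g z).
Proof.
elim: m k => [|m ih] k /=.
  by split=> [z|//]; split=> // h g B _ _ _.
split=> [z|g bg].
  exact: mean_bker ((bker_cstep k).1 z) (ih k.+1).
exact/(bker_cstep k).2/(ih _).2.
Qed.

Lemma bker_kexp m : bker (fun x (g : X -> R) => kexp m g x).
Proof.
elim: m => [|m ih] /=.
  by split=> [x|//]; split=> // h g B _ _ _.
split=> [x|g bg]; first exact: mean_bker (mean_ker P x) ih.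
exact/(bker_ker P).2/ih.2.
Qed.

Lemma cexpS m k f z :
  cexp m.+1 k f z = \int[P (co z k)]_y cexp m k.+1 f (upd z k.+1 y).
Proof. by []. Qed.

Lemma cexpD a b k f : cexp (a + b) k f = cexp a k (cexp b (k + a) f).
Proof.
elim: a k => [|a ih] k; first by rewrite addn0.
by rewrite addSn /= ih addSnnS.
Qed.

(** Each step overwrites the next coordinate using only the current one. With [lo = k] this is the
    Markov property. *)
Lemma cexp_dep m k lo f z x : (lo <= k)%N -> (k + m <= N)%N ->
  (forall z x, (forall l, (lo <= l <= k + m)%N -> co z l = co x l) ->
     f z = f x) ->
  (forall l, (lo <= l <= k)%N -> co z l = co x l) ->
  cexp m k f z = cexp m k f x.
Proof.
elim: m k z x => [|m ih] k z x lok kmN fdep zx.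
  by apply: fdep; rewrite addn0.
rewrite !cexpS zx ?lok ?leqnn//; apply: eq_Rintegral => y _.
rewrite addnS -addSn in kmN fdep.
apply: ih => //; first exact: leqW.
move=> l /andP[lol lk].
rewrite !co_upd; last 2 first.
- by rewrite (leq_trans lk)// (leq_trans _ kmN)// leq_addr.
- by rewrite (leq_trans lk)// (leq_trans _ kmN)// leq_addr.
case: eqVneq => // lk1; apply: zx.
by rewrite lol -ltnS ltn_neqAle lk1.
Qed.

Lemma cexp_kexp a k (g : X -> R) z : (k + a <= N)%N ->
  cexp a k (fun z => g (co z (k + a))) z = kexp a g (co z k).
Proof.
elim: a k z => [|a ih] k z kaN; first by rewrite /= addn0.
rewrite cexpS /=; apply: eq_Rintegral => y _.
rewrite addnS -addSn in kaN *.
rewrite ih// co_upd ?eqxx//.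
by rewrite (leq_trans _ kaN)// leq_addr.
Qed.

End path_operators.

(** * Iterates of the kernel and total variation *)

Section kernel_iterates.
Context {d : measure_display} {X : measurableType d} {R : realType}.
Variable P : R.-pker X ~> X.

Lemma kiterE m A x : measurable A -> kiter P m x A = (kexp P m \1_A x)%:E.
Proof.
move=> mA; elim: m x => [|m ih] x /=; first by rewrite diracE indicE.
under eq_integral do rewrite ih.
rewrite fineK//; apply: integrable_fin_num => //; apply: bm_integrable.
  exact: prob_kernel.
exact/(bker_kexp P m).2/bm_indic.
Qed.

Lemma prob_Rintegral (mu : probability X R) A : measurable A ->
  mu A = (\int[mu]_x \1_A x)%:E.
Proof.
move=> mA; rewrite /Rintegral integral_indic// setIT fineK//.
exact: fin_num_measure.
Qed.

Lemma kexp_dTV (pi : probability X R) D m x (g : X -> R) c : 0 <= c ->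
  (dTV (kiter P m x) pi <= D%:E)%E ->
  measurable_fun [set: X] g -> (forall y, `|g y| <= c) ->
  `|kexp P m g x - \int[pi]_y g y| <= 2 * c * D.
Proof.
move=> c0 HD mg gc.
apply: (@mean_dist _ _ _ (fun h => kexp P m h x) (fun h => \int[pi]_y h y))
  => //.
- exact: (bker_kexp P m).1.
- by apply: mean_Rintegral; exact: probability_setT.
- move=> A mA; rewrite -lee_fin (le_trans _ HD)//.
  apply: ereal_sup_ubound; exists A => //.
  by rewrite kiterE// prob_Rintegral.
Qed.

End kernel_iterates.

(** * Functionals on path space determined by measurable rectangles *)

Section rectangles.
Context {d : measure_display} {X : measurableType d} {N : nat}.
Local Notation Z := (N.+1.-tuple X).

Definition rect (As : seq (set X)) : set Z :=
  [set z | forall i, (i < N.+1)%N -> nth set0 As i (co z i)].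

Definition rects : set (set Z) := [set A | exists As : seq (set X),
  [/\ size As = N.+1, forall i, (i < N.+1)%N -> measurable (nth set0 As i) &
      A = rect As]].

Lemma rects_setI : setI_closed rects.
Proof.
move=> _ _ [As [sA mA ->]] [Bs [sB mB ->]].
exists (mkseq (fun i => nth set0 As i `&` nth set0 Bs i) N.+1); split.
- by rewrite size_mkseq.
- by move=> i iN; rewrite nth_mkseq//; apply: measurableI; [exact: mA|exact: mB].
- rewrite eqEsubset; split => [z [zA zB] i iN|z zAB].
    by rewrite nth_mkseq//; split; [exact: zA|exact: zB].
  by split => i iN; have := zAB _ iN; rewrite nth_mkseq// => -[].
Qed.

Lemma measurable_rect As : (forall i, (i < N.+1)%N -> measurable (nth set0 As i)) ->
  measurable (rect As).
Proof.
move=> mA.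
have -> : rect As = \bigcap_(i in `I_N.+1) ((@co d X N)^~ i @^-1` nth set0 As i).
  by rewrite eqEsubset; split => z /= zA i iN; exact: zA.
apply: fin_bigcap_measurable => [|i iN]; first exact: finite_II.
by rewrite -[_ @^-1` _]setTI; apply: measurable_co => //; exact: mA.
Qed.

Lemma measurable_rects : @measurable _ Z = <<s rects >>.
Proof.
rewrite eqEsubset; split.
  apply: smallest_sub; first exact: smallest_sigma_algebra.
  rewrite -bigcup_mkord_ord; apply: bigcup_sub => i iN _ [B mB <-].
  apply: sub_sigma_algebra.
  exists (mkseq (fun j => if j == i then B else setT) N.+1); split.
  - by rewrite size_mkseq.
  - by move=> j jN; rewrite nth_mkseq//; case: ifP.
  - rewrite setTI eqEsubset; split => z /= => [zB j jN|/(_ _ iN)].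
      by rewrite nth_mkseq//; case: eqVneq => // ->.
    by rewrite nth_mkseq// eqxx.
apply: smallest_sub; first exact: sigma_algebra_measurable.
by move=> _ [As [_ mA ->]]; exact: measurable_rect.
Qed.

(** Dynkin's pi-lambda argument extends the equality from rectangles to all measurable sets;
    [mean_dist] with [D = 0] then passes to bounded functions. *)
Lemma mean_rect_eq (R : realType) (L1 L2 : (Z -> R) -> R) :
  mean L1 -> mean L2 ->
  (forall As : seq (set X), size As = N.+1 ->
    (forall i, (i < N.+1)%N -> measurable (nth set0 As i)) ->
    L1 \1_(rect As) = L2 \1_(rect As)) ->
  forall g, bm g -> L1 g = L2 g.
Proof.
move=> m1 m2 H g bg.
suff E A : measurable A -> L1 \1_A = L2 \1_A.
  have [mg [B gB]] := bg.
  have := @mean_dist _ _ _ L1 L2 m1 m2 0 _ g `|B| (normr_ge0 _) mg.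
  rewrite mulr0 normr_le0 subr_eq0 => h; apply/eqP/h.
  - by move=> A mA; rewrite E// subrr normr0.
  - by move=> t; rewrite (le_trans (gB t))// ler_norm.
have := @dynkin_induction _ _ rects (fun A => L1 \1_A = L2 \1_A)
  measurable_rects rects_setI.
rewrite -measurable_rects => D; move: A; apply: D.
- by rewrite indicT !mean_cst.
- by move=> _ [As [sA mA ->]]; exact: H.
- move=> S mS; have -> : \1_(~` S) = fun t => 1 - \1_S t :> R.
    by apply/funext => t; rewrite !indicE in_setC; case: (_ \in _); rewrite ?subr0 ?subrr.
  by rewrite !meanB ?mean_cst//; try exact: bm_cst; try exact: bm_indic => //; move=> ->.
- move=> F mF tF EF.
  pose h n t : R := \sum_(k <- index_iota 0 n) \1_(F k) t.
  have bh n : bm (h n) by apply: bm_sum => k; exact: bm_indic.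
  have bU : bm (\1_(\bigcup_k F k) : Z -> R).
    by apply: bm_indic; exact: bigcupT_measurable.
  have hg t : h n t @[n --> \oo] --> (\1_(\bigcup_k F k) t : R).
    have hE : EFin \o (fun n => h n t) = fun n => (\sum_(0 <= k < n) (\1_(F k) t)%:E)%E.
      by apply/funext => n; rewrite /= /h sumEFin.
    suff : EFin \o (fun n => h n t) @ \oo --> (\1_(\bigcup_k F k) t : R)%:E.
      by move/fine_cvg.
    rewrite hE [X in _ --> X](indic_bigcup _ tF).
    by apply: is_cvg_nneseries => n _ _; rewrite lee_fin.
  (* Disjointness keeps the partial sums below the indicator of the union, which gives the uniform
     bound for bounded convergence. *)
  have hB n t : `|h n t| <= 1.
    rewrite ger0_norm ?sumr_ge0// -lee_fin.
    apply: (@le_trans _ _ (\1_(\bigcup_k F k) t)%:E); last first.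
      by rewrite lee_fin indicE; case: (_ \in _).
    rewrite (indic_bigcup _ tF) /h -sumEFin.
    by apply: nneseries_lim_ge => k _ _; rewrite lee_fin.
  have Eh n : L1 (h n) = L2 (h n).
    rewrite !mean_sum//; try by move=> k; exact: bm_indic.
    by apply: eq_bigr => k _; exact: EF.
  have c1 := mean_cvg _ m1 h _ 1 bh bU hB hg.
  have c2 := mean_cvg _ m2 h _ 1 bh bU hB hg.
  apply: (cvg_unique _ c1) => //.
  by rewrite (_ : (fun n => L1 (h n)) = (fun n => L2 (h n)))//; apply/funext.
Qed.

End rectangles.

(** * Finite-dimensional distributions and the law of the chain *)

Section finite_dimensional.
Context {d : measure_display} {X : measurableType d} {R : realType} {N : nat}.
Variable P : R.-pker X ~> X.
Local Notation Z := (N.+1.-tuple X).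

Fixpoint rfdd (As : seq (set X)) (y : X) : R :=
  match As with
  | [::] => 1
  | A :: As' => \1_A y * \int[P y]_z rfdd As' z
  end.

Lemma bm_rfdd As : (forall i, (i < size As)%N -> measurable (nth set0 As i)) ->
  bm (rfdd As).
Proof.
elim: As => [|A As ih] mAs /=; first exact: bm_cst.
apply: bmM; first by apply: bm_indic; exact: (mAs 0).
by apply: (bker_ker P).2; apply: ih => i iA; exact: (mAs i.+1).
Qed.

Lemma fddE As y : (forall i, (i < size As)%N -> measurable (nth set0 As i)) ->
  fdd P As y = (rfdd As y)%:E.
Proof.
elim: As y => [|A As ih] y mAs //=.
have mAs' i : (i < size As)%N -> measurable (nth set0 As i).
  by move=> iA; exact: (mAs i.+1).
rewrite EFinM; congr (_ * _)%E.
under eq_integral do rewrite ih//.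
rewrite fineK//; apply: integrable_fin_num => //; apply: bm_integrable.
  exact: prob_kernel.
exact: bm_rfdd.
Qed.

Lemma indic_rect As (z : Z) :
  \1_(rect As) z = \prod_(i < N.+1) \1_(nth set0 As i) (co z i) :> R.
Proof.
rewrite indicE; have [|zA] := boolP (z \in rect As).
  rewrite inE => zA; rewrite big1// => i _.
  by rewrite indicE mem_set//; exact: zA.
have [i zi] : exists i : 'I_N.+1, ~ nth set0 As i (co z i).
  apply: contrapT => H; move: zA; rewrite notin_setE; apply => i iN.
  by apply: contrapT => h; apply: H; exists (Ordinal iN).
by apply/esym/eqP/prodf_eq0; exists i => //; rewrite indicE memNset.
Qed.

Lemma cexp_rect As m k (z : Z) : size As = N.+1 -> (k + m = N)%N ->
  (forall i, (i < N.+1)%N -> measurable (nth set0 As i)) ->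
  cexp P m k \1_(rect As) z =
  (\prod_(i < k) \1_(nth set0 As i) (co z i)) * rfdd (drop k As) (co z k).
Proof.
move=> sA; elim: m k z => [|m ih] k z kmN mA.
  rewrite addn0 in kmN; rewrite /= indic_rect big_ord_recr/= kmN; congr (_ * _).
  rewrite (drop_nth set0) ?sA// drop_oversize ?sA//=.
  by rewrite (mean_cst _ (mean_ker P (co z N))) mulr1.
have kN : (k < N)%N by rewrite -kmN addnS ltnS leq_addr.
rewrite cexpS; under eq_Rintegral => y _.
  rewrite ih ?addSnnS// co_upd// eqxx.
  rewrite (eq_bigr (fun i : 'I_k.+1 => \1_(nth set0 As i) (co z i))); last first.
    move=> i _; rewrite co_upd ?ltn_eqF//.
    by rewrite (leq_trans _ (ltnW kN))// -ltnS.
  over.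
rewrite (meanZ _ (mean_ker P (co z k))); last first.
  apply: bm_rfdd => i; rewrite size_drop sA => iN; rewrite nth_drop.
  by apply: mA; rewrite -ltn_subRL.
rewrite big_ord_recr/= -mulrA [in RHS](drop_nth set0) ?sA//.
exact: ltnW.
Qed.

End finite_dimensional.

Section law.
Context {d : measure_display} {X : measurableType d} {R : realType} {N : nat}.
Context {dO : measure_display} {O : measurableType dO}.
Variables (P : R.-pker X ~> X) (Pr : probability O R) (Xs : nat -> O -> X).
Variable x : X.
Hypothesis Hchain : markov_chain P Pr Xs x.
Local Notation Z := (N.+1.-tuple X).

Definition traj w : Z := [tuple Xs i w | i < N.+1].

Lemma co_traj w i : (i <= N)%N -> co (traj w) i = Xs i w.
Proof. by move=> iN; rewrite /co tnth_mktuple inordK. Qed.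

Lemma measurable_traj : measurable_fun [set: O] traj.
Proof.
apply/measurable_fun_tnthP => i.
rewrite (_ : _ \o _ = Xs i); first exact: Hchain.1.
by apply/funext => w /=; rewrite tnth_mktuple.
Qed.

Lemma mean_traj : mean (fun g : Z -> R => \int[Pr]_w g (traj w)).
Proof.
apply: mean_comp measurable_traj; apply: mean_Rintegral.
exact: probability_setT.
Qed.

(** Both sides are means that agree on rectangles by the definition of a Markov chain. From here on,
    expectations over [Pr] can be computed with the path operators; only coordinate 0 of [z] is
    prescribed. *)
Lemma traj_cexp (g : Z -> R) z : bm g -> co z 0 = x ->
  \int[Pr]_w g (traj w) = cexp P N 0 g z.
Proof.
move=> + zx; move: g.
apply: (mean_rect_eq _ (fun g => \int[Pr]_w g (traj w)) (fun g => cexp P N 0 g z)).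
- exact: mean_traj.
- exact: (bker_cexp P N 0).1.
- move=> As sA mA.
  rewrite cexp_rect// big_ord0 mul1r drop0 zx.
  apply: EFin_inj; rewrite -fddE ?sA//.
  have [_ <-] := Hchain; last by rewrite sA.
  have -> : [set w | forall i, (i < size As)%N -> nth set0 As i (Xs i w)] =
      traj @^-1` rect As.
    rewrite eqEsubset sA; split=> w wA i iN; have := wA i iN;
    by rewrite co_traj.
  rewrite prob_Rintegral// -[_ @^-1` _]setTI; apply: measurable_traj => //.
  exact: measurable_rect.
Qed.

End law.

(** * Return times *)

(** The integral of a nonnegative function is a supremum over the simple functions below it, hence
    monotone for arbitrary functions. This makes it possible to bound [pow_sigma] from below without
    discussing its measurability. *)
Lemma ge0_le_integral_nonmeasurable d (T : measurableType d) (R : realType)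
    (mu : {measure set T -> \bar R}) (f g : T -> \bar R) :
  (forall t, 0 <= f t)%E -> (forall t, f t <= g t)%E ->
  (\int[mu]_t f t <= \int[mu]_t g t)%E.
Proof.
move=> f0 fg.
rewrite !ge0_integralTE//; last by move=> t; exact: le_trans (f0 t) (fg t).
apply: le_ereal_sup => _ [h hf <-]; exists h => // t.
exact: le_trans (hf t) (fg t).
Qed.

(** Writes a power of a truncated time as a sum over the tail events [j < a], whose expectations are
    survival probabilities. *)
Lemma geo_telescope (R : realType) (u : R) m a :
  1 + \sum_(j < m) (u - 1) * u ^+ j * (j < a)%N%:R = u ^+ (minn m a).
Proof.
elim: m => [|m ih]; first by rewrite big_ord0 addr0 min0n.
rewrite big_ord_recr/= addrA ih; have [ma|am] := ltnP m a.
  by rewrite (minn_idPl ma) exprS mulr1; ring.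
by rewrite (minn_idPr (leqW am)) mulr0 addr0.
Qed.

Section return_time.
Context {d : measure_display} {X : measurableType d} {R : realType}.
Context {dO : measure_display} {O : measurableType dO}.
Variables (P : R.-pker X ~> X) (C : set X) (mC : measurable C) (u : R).

(* [vret m y] is the expectation of [u] to the power [min(tau, m)], where [tau]
   is the hitting time of [C] by the chain started at [y]. *)
Fixpoint vret m (y : X) : R :=
  if m is m'.+1 then if y \in C then 1 else u * \int[P y]_z vret m' z else 1.

Lemma bm_vret m : bm (vret m).
Proof.
elim: m => [|m ih] /=; first exact: bm_cst.
apply: bm_if => //; first exact: bm_cst.
exact/bmZ/(bker_ker P).2.
Qed.

(** The probability that the chain started at a point avoids [C] at all times from 0 to [j]. *)
Let surv j := rfdd P (nseq j.+1 (~` C)).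

Let bm_surv j : bm (surv j).
Proof.
apply: bm_rfdd => i; rewrite size_nseq => ij; rewrite nth_nseq ij.
exact: measurableC.
Qed.

Let int_survE m y : \int[P y]_z (1 + \sum_(j < m) (u - 1) * u ^+ j * surv j z)
  = 1 + \sum_(j < m) (u - 1) * u ^+ j * \int[P y]_z surv j z.
Proof.
have mP := mean_ker P y.
rewrite (meanD _ mP); [|exact: bm_cst|by apply: bm_sum => j; exact: bmZ].
rewrite (mean_cst _ mP) (mean_sum _ mP); last by move=> j; exact: bmZ.
by congr (_ + _); apply: eq_bigr => j _; rewrite (meanZ _ mP).
Qed.

(** This is [geo_telescope] in expectation, [surv j] being the probability of [tau > j]. All terms
    vanish on [C]; off [C], [surv j.+1] is the one-step average of [surv j]. *)
Let vretE m y : vret m y = 1 + \sum_(j < m) (u - 1) * u ^+ j * surv j y.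
Proof.
elim: m y => [|m ih] y; first by rewrite big_ord0 addr0.
rewrite /=; case: ifPn => yC.
  rewrite big1 ?addr0// => j _.
  by rewrite /surv/= indicE in_setC yC mul0r mulr0.
under eq_Rintegral do rewrite ih.
rewrite int_survE big_ord_recl/= expr0 mulr1 mulrDr mulr1 mulr_sumr addrA.
rewrite /surv/= indicE in_setC yC !mul1r (mean_cst _ (mean_ker P y)).
rewrite ?mulr1; congr (_ + _); first by ring.
apply: eq_bigr => j _.
by rewrite /bump/= exprS; ring.
Qed.

Variables (Pr : probability O R) (Xs : nat -> O -> X) (x : X) (M : R).
Hypothesis Hchain : markov_chain P Pr Xs x.
Hypothesis u1 : 1 < u.
Hypothesis Hret : (\int[Pr]_w pow_sigma u Xs C w <= M%:E)%E.

(** The event that the return time exceeds [j + 1]; time 0 is left out, unlike in [surv]. *)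
Let avoid j := [set w | forall i, (0 < i <= j.+1)%N -> ~ C (Xs i w)].

Let measurable_avoid j : measurable (avoid j).
Proof.
have -> : avoid j = \bigcap_(i in [set i | (0 < i <= j.+1)%N]) (Xs i @^-1` (~` C)).
  by rewrite eqEsubset; split => w /= H i /H.
apply: bigcap_measurable => [|i _]; first by exists 1%N.
by rewrite -[_ @^-1` _]setTI; apply: Hchain.1 => //; exact: measurableC.
Qed.

Let prob_avoid j : \int[Pr]_w \1_(avoid j) w = \int[P x]_z surv j z.
Proof.
apply: EFin_inj; rewrite -prob_Rintegral//.
pose As := [set: X] :: nseq j.+1 (~` C).
have sAs : size As = j.+2 by rewrite /= size_nseq.
have nAs i : (i <= j)%N -> nth set0 As i.+1 = ~` C.
  by move=> ij; rewrite [LHS]nth_nseq ltnS ij.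
have mAs i : (i < size As)%N -> measurable (nth set0 As i).
  case: i => [_|i]; first exact: measurableT.
  by rewrite sAs !ltnS => ij; rewrite nAs//; exact: measurableC.
have := Hchain.2 As mAs; rewrite fddE// [rfdd _ _ _]/= indicT mul1r => <-.
congr (Pr _); rewrite eqEsubset sAs; split => w /= H.
  by move=> [|i]//; rewrite !ltnS => ij; rewrite nAs//; apply: H.
move=> [|i]//; rewrite ltnS => ij; have := H i.+1.
by rewrite nAs//; apply; rewrite ltnS.
Qed.

(** By [geo_telescope], the left side is [u] to the power [1 + min(m, sigma - 1)] when [sigma] is
    finite. *)
Let pow_sigma_ge m w :
  ((u * (1 + \sum_(j < m) (u - 1) * u ^+ j * \1_(avoid j) w))%:E
    <= pow_sigma u Xs C w)%E.
Proof.
rewrite /pow_sigma /sigma_time; case: pselect => [h|]; last by rewrite leey.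
case: ex_minnP => s /asboolP[s0 Cs] smin; rewrite lee_fin.
rewrite (eq_bigr (fun j : 'I_m => (u - 1) * u ^+ j * (j < s.-1)%N%:R)); last first.
  move=> j _; congr (_ * _); rewrite indicE; congr (nat_of_bool _)%:R.
  apply/idP/idP; rewrite inE /avoid/= => H.
    rewrite ltnNge; apply/negP => sj; apply: (H s) => //.
    by rewrite s0 -(prednK s0) ltnS.
  move=> i /andP[i0 ij] Ci; rewrite ltn_predRL in H.
  have /smin : `[< (0 < i)%N /\ C (Xs i w) >] by exact/asboolP.
  by rewrite leqNgt (leq_ltn_trans ij H).
rewrite geo_telescope -exprS ler_weXn2l// ?ltW//.
by rewrite (leq_trans (_ : _ <= s.-1.+1)%N) ?ltnS ?geq_minr// (prednK s0).
Qed.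

(** After one step, the return time is 1 plus the hitting time from the new state, so the moment
    hypothesis on the former bounds the truncated moments of the latter. *)
Lemma vret_le m : u * \int[P x]_y vret m y <= M.
Proof.
under eq_Rintegral do rewrite vretE.
rewrite int_survE.
have mPr := mean_Rintegral _ (probability_setT Pr).
have bA j : bm (\1_(avoid j) : O -> R) by exact: bm_indic.
under eq_bigr do rewrite -prob_avoid -(meanZ _ mPr)//.
rewrite -(mean_sum _ mPr); last by move=> j; exact: bmZ.
have bS : bm (fun w => \sum_(j < m) (u - 1) * u ^+ j * \1_(avoid j) w).
  by apply: bm_sum => j; exact: bmZ.
have b1 : bm ((fun=> 1) : O -> R) by exact: bm_cst.
rewrite -[X in X + _](mean_cst _ mPr) -(meanD _ mPr)// -(meanZ _ mPr); last exact: bmD.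
rewrite -lee_fin (le_trans _ Hret)// fineK; last first.
  apply: integrable_fin_num => //; apply: bm_integrable; first exact: probability_setT.
  by apply: bmZ; exact: bmD.
apply: ge0_le_integral_nonmeasurable => w; last exact: pow_sigma_ge.
rewrite lee_fin mulr_ge0//; first by rewrite ltW// (lt_trans _ u1).
rewrite addr_ge0// sumr_ge0// => j _.
by rewrite !mulr_ge0 ?subr_ge0 ?(ltW u1)// ?exprn_ge0 ?indicE// ltW// (lt_trans _ u1).
Qed.

End return_time.

(** * Weighted sums *)

(** From [exp (-x) >= 1 - x] comes [exp x - 1 <= x exp x]. Multiplying it by [x] settles [x >= 0];
    for [x < 0], [1 - exp x <= - x] is multiplied by [- x]. *)
Lemma expR_le_quadratic (R : realType) (x : R) :
  expR x <= 1 + x + x ^+ 2 * expR `|x|.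
Proof.
have key : expR x - 1 <= x * expR x.
  have := expR_ge1Dx (- x); rewrite expRN -(ler_pM2r (expR_gt0 x)).
  by rewrite mulVf ?gt_eqF ?expR_gt0//; lra.
have [x0|x0] := leP 0 x.
  rewrite ger0_norm//; have := ler_wpM2l x0 key; lra.
have e1 : 1 <= expR `|x| by rewrite -expR0 ler_expR.
have h : 1 - expR x <= - x by have := expR_ge1Dx x; lra.
have := ler_wpM2l (sqr_ge0 x) e1; have x0' : 0 <= - x by lra.
have := ler_wpM2l x0' h; lra.
Qed.

(** Cauchy-Schwarz with weights [b_i]; the cross terms are absorbed by
    [2 c_i c_j <= c_i^2 + c_j^2]. *)
Lemma sqr_sum_le (R : realType) (I : Type) (s : seq I) (b c : I -> R) :
  (forall i, 0 <= b i) -> (forall i, 0 <= c i) ->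
  (\sum_(i <- s) b i * c i) ^+ 2 <=
  (\sum_(i <- s) b i) * (\sum_(i <- s) b i * c i ^+ 2).
Proof.
move=> b0 c0; elim: s => [|i s ih]; first by rewrite !big_nil expr0n mul0r.
rewrite !big_cons; set S := \sum_(j <- s) b j * c j in ih *.
set B := \sum_(j <- s) b j in ih *.
set Q := \sum_(j <- s) b j * c j ^+ 2 in ih *.
have key : 2 * c i * S <= Q + c i ^+ 2 * B.
  rewrite /S /Q /B !mulr_sumr -big_split; apply: ler_sum => j _ /=.
  have := mulr_ge0 (b0 j) (sqr_ge0 (c j - c i)); lra.
have := ler_wpM2l (b0 i) key; lra.
Qed.

Lemma geo_sum_le (R : realType) (q : R) n : 0 <= q < 1 ->
  \sum_(0 <= i < n) q ^+ i.+1 <= (1 - q)^-1.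
Proof.
move=> /andP[q0 q1]; have q1' : 0 < 1 - q by rewrite subr_gt0.
rewrite -[leRHS]mulr1 ler_pdivlMl//.
suff -> : (1 - q) * \sum_(0 <= i < n) q ^+ i.+1 = q - q ^+ n.+1.
  by rewrite lerBlDr ler_wpDr ?exprn_ge0// ltW.
elim: n => [|n ih]; first by rewrite big_geq// mulr0 expr1 subrr.
by rewrite big_nat_recr//= mulrDr ih [q ^+ n.+2]exprS; ring.
Qed.

Lemma geo_sum_le_after (R : realType) (q : R) k n : 0 <= q < 1 ->
  \sum_(k.+1 <= i < n) q ^+ (i - k) <= (1 - q)^-1.
Proof.
move=> q01; rewrite -[k.+1]add0n big_addn.
under eq_bigr => i _ do rewrite addnS -addSn addnK.
exact: geo_sum_le.
Qed.

Lemma geo_sum_le_before (R : realType) (q : R) i : 0 <= q < 1 ->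
  \sum_(0 <= l < i) q ^+ (i - l) <= (1 - q)^-1.
Proof.
move=> q01; rewrite big_nat_rev/= big_nat_cond.
under eq_bigr => l /andP[/andP[_ li] _] do rewrite add0n subKn//.
by rewrite -big_nat_cond; exact: geo_sum_le.
Qed.

Section weights.
Context {R : realType} (N : nat) (u M r rho L : R) (c : nat -> R).
Hypotheses (L1 : 1 <= L) (M1 : 1 <= M) (rho01 : 0 < rho < 1).
Hypotheses (r_rho : 0 <= r <= rho) (u_rho : 1 <= u * rho ^+ 4).
Hypothesis c_ge0 : forall i, 0 <= c i.

(* Bounds the change of the conditional expectation of [f] between a visit to
   [C] at time [k] and the next visit at time [j]. *)
Definition drift k j : R :=
  \sum_(k.+1 <= i < N.+1) (if (i <= j)%N then 1 else 4 * L * r ^+ (i - j)) * c i.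

(** The price, in the exponent of the moment generating function, of an excursion that leaves [C] at
    time [k]. *)
Definition weight k : R := 16 * M * L ^+ 2 / (1 - rho) *
  \sum_(k.+1 <= i < N.+1) rho ^+ (i - k) * c i ^+ 2.

Definition mgf_const : R := 16 * M * L ^+ 2 / (1 - rho) ^+ 2.

Let rho0 : 0 < rho. Proof. by case/andP: rho01. Qed.
Let rho1 : 0 < 1 - rho. Proof. by rewrite subr_gt0; case/andP: rho01. Qed.
Let rhoV : 1 <= rho^-1. Proof. by rewrite invf_ge1 ?posrE//; case/andP: rho01 => _ /ltW. Qed.
Let L0 : 0 < L. Proof. by rewrite (lt_le_trans ltr01). Qed.
Let M0 : 0 < M. Proof. by rewrite (lt_le_trans ltr01). Qed.
Let rho01' : 0 <= rho < 1. Proof. by case/andP: rho01 => /ltW -> ->. Qed.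
Let rr : r <= rho. Proof. by case/andP: r_rho. Qed.
Let r0 : 0 <= r. Proof. by case/andP: r_rho. Qed.

Lemma weight_ge0 k : 0 <= weight k.
Proof.
rewrite /weight mulr_ge0//.
  by rewrite divr_ge0 ?mulr_ge0 ?exprn_ge0 ?ltW.
by apply: sumr_ge0 => i _; rewrite mulr_ge0 ?exprn_ge0// ltW.
Qed.

Lemma drift_ge0 k j : 0 <= drift k j.
Proof.
apply: sumr_ge0 => i _; apply: mulr_ge0 => //; case: ifP => // _.
by rewrite !mulr_ge0 ?exprn_ge0// ltW.
Qed.

(** Each coefficient of [drift k j] is at most [4 L rho^(i - k) q] with [q = rho^-(j - k)]: for
    [i <= j] since [rho^(i - k) q >= 1], and for [i > j] since [r <= rho]. Weighted Cauchy-Schwarz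
    applies, the weights having sum at most [4 L q / (1 - rho)]. *)
Let sqr_drift_le k j : (k < j)%N -> drift k j ^+ 2 <=
  16 * L ^+ 2 / (1 - rho) * rho^-1 ^+ (2 * (j - k)) *
  \sum_(k.+1 <= i < N.+1) rho ^+ (i - k) * c i ^+ 2.
Proof.
move=> kj; set q := rho^-1 ^+ (j - k).
have q0 : 0 < q by rewrite exprn_gt0// invr_gt0.
have dle : drift k j <=
    \sum_(k.+1 <= i < N.+1) (4 * L * (rho ^+ (i - k) * q)) * c i.
  apply: ler_sum_nat => i /andP[ki iN]; apply: ler_wpM2r => //.
  case: ifPn => [ij|].
    have : 1 <= rho ^+ (i - k) * q.
      have -> : q = rho^-1 ^+ (i - k) * rho^-1 ^+ (j - i).
        by rewrite -exprD addnC addnBA ?subnK// ltnW.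
      rewrite mulrA -exprMn divff ?gt_eqF// expr1n mul1r.
      by rewrite exprn_ege1.
    by move: L1; nra.
  rewrite -ltnNge => ji; rewrite ler_wpM2l ?mulr_ge0 ?(ltW L0)//.
  have -> : rho ^+ (i - k) = rho ^+ (i - j) * rho ^+ (j - k).
    by rewrite -exprD addnBA ?subnK// ltnW.
  rewrite -mulrA -exprMn divff ?gt_eqF// expr1n mulr1.
  by rewrite lerXn2r ?nnegrE ?(ltW rho0).
apply: le_trans (_ : _ <= (\sum_(k.+1 <= i < N.+1) 4 * L * (rho ^+ (i - k) * q) * c i) ^+ 2) _.
  rewrite lerXn2r ?nnegrE ?drift_ge0//; exact: le_trans (drift_ge0 k j) dle.
have b0 i : 0 <= 4 * L * (rho ^+ (i - k) * q).
  by apply: mulr_ge0; apply: mulr_ge0 => //; [exact: ltW|exact/exprn_ge0/ltW|exact: ltW].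
apply: le_trans (sqr_sum_le _ _ _ _ _ b0 c_ge0) _.
rewrite -mulr_sumr -mulr_suml.
have -> : \sum_(k.+1 <= i < N.+1) 4 * L * (rho ^+ (i - k) * q) * c i ^+ 2 =
    4 * L * q * \sum_(k.+1 <= i < N.+1) rho ^+ (i - k) * c i ^+ 2.
  by rewrite mulr_sumr; apply: eq_bigr => i _; ring.
set Q := \sum_(k.+1 <= i < N.+1) rho ^+ (i - k) * c i ^+ 2.
have Q0 : 0 <= Q.
  by apply: sumr_ge0 => i _; rewrite mulr_ge0 ?exprn_ge0// ltW.
rewrite mulnC exprM -/q.
have := geo_sum_le_after _ rho k N.+1 rho01'; set G := \sum_(_ <= _ < _) _ => HG.
have -> : 16 * L ^+ 2 / (1 - rho) * q ^+ 2 * Q =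
    4 * L * ((1 - rho)^-1 * q) * (4 * L * q * Q) by ring.
rewrite ler_wpM2r ?mulr_ge0 ?(ltW L0) ?(ltW q0)//.
by rewrite ler_wpM2l ?mulr_ge0 ?(ltW L0)// ler_wpM2r// ltW.
Qed.

Hypothesis c_small : forall i, c i <= 2 / mgf_const.

(** With [e = 2 / mgf_const] bounding every [c_i], the drift is at most
    [e (j - k) + e 4 L / (1 - rho)]. Both [e] and [e 4 L / (1 - rho)] are at most [1 - rho], and
    [j - k >= 1]. *)
Let drift_le k j : (k < j)%N -> (j <= N)%N ->
  drift k j <= 2 * (1 - rho) * (j - k)%:R.
Proof.
move=> kj jN.
have e_def : 2 / mgf_const = (1 - rho) ^+ 2 / (8 * M * L ^+ 2).
  by rewrite /mgf_const; field; rewrite ?gt_eqF.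
have e1 : 2 / mgf_const <= 1 - rho.
  rewrite e_def ler_pdivrMr ?mulr_gt0 ?exprn_gt0//.
  rewrite expr2 ler_pM2l//.
  have : 1 <= M * L ^+ 2 by rewrite -[1]mulr1 ler_pM// exprn_ege1.
  have := rho0; lra.
have e2 : 2 / mgf_const * (4 * L / (1 - rho)) <= 1 - rho.
  have -> : 2 / mgf_const * (4 * L / (1 - rho)) = (1 - rho) / (2 * M * L).
    by rewrite e_def; field; rewrite ?gt_eqF.
  rewrite ler_pdivrMr ?mulr_gt0// ler_peMr ?ltW//.
  have : 1 <= M * L by rewrite -[1]mulr1 ler_pM.
  lra.
have e0 : 0 <= 2 / mgf_const by exact: le_trans (c_ge0 0%N) (c_small 0%N).
have s1 : 1 <= (j - k)%:R :> R by rewrite ler1n subn_gt0.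
apply: le_trans (_ : _ <= 2 / mgf_const * ((j - k)%:R + 4 * L / (1 - rho))) _.
  apply: le_trans (_ : _ <= \sum_(k.+1 <= i < N.+1)
      (if (i <= j)%N then 1 else 4 * L * r ^+ (i - j)) * (2 / mgf_const)) _.
    apply: ler_sum => i _; apply: ler_wpM2l => //; case: ifP => // _.
    by rewrite !mulr_ge0 ?exprn_ge0// ltW.
  rewrite -mulr_suml mulrC ler_wpM2l//.
  rewrite (big_cat_nat (n := j.+1)) ?ltnS ?(ltnW kj)//=; apply: lerD.
    rewrite big_nat_cond (eq_bigr (fun=> 1)); last first.
      by move=> i /andP[/andP[_]]; rewrite ltnS => ->.
    by rewrite -big_nat_cond sumr_const_nat subSS.
  rewrite big_nat_cond (eq_bigr (fun i => 4 * L * r ^+ (i - j))); last first.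
    by move=> i /andP[/andP[ji _] _]; rewrite leqNgt ji.
  rewrite -big_nat_cond -mulr_sumr ler_wpM2l ?mulr_ge0 ?(ltW L0)//.
  apply: le_trans (geo_sum_le_after _ rho j N.+1 rho01').
  apply: ler_sum => i _; by rewrite lerXn2r ?nnegrE ?(ltW rho0).
rewrite mulrDr.
have := ler_wpM2r (ler0n R (j - k)) e1; have := ler_wpM2l (ltW rho1) s1; lra.
Qed.

(** Write [s = j - k]. As [exp (1 - rho) <= 1 / rho], the exponential is at most [rho^-(2 s)]; the
    squared drift brings another [rho^-(2 s)]. The product [rho^-(4 s)] is at most [u^s], which is
    why [rho] has to be at least [u^(-1/4)]. *)
Lemma drift_weight k j : (k < j)%N -> (j <= N)%N ->
  drift k j ^+ 2 * expR (drift k j) <= weight k / M * u ^+ (j - k).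
Proof.
move=> kj jN; set s := (j - k)%N.
have es : expR (drift k j) <= rho^-1 ^+ (2 * s).
  apply: le_trans (_ : _ <= expR (2 * (1 - rho) * s%:R)) _.
    by rewrite ler_expR drift_le.
  rewrite (_ : 2 * (1 - rho) * s%:R = (2 * s)%:R * (1 - rho)); last first.
    by rewrite natrM; ring.
  rewrite expRM_natl lerXn2r ?nnegrE ?expR_ge0 ?invr_ge0 ?(ltW rho0)//.
  rewrite -[1 - rho]opprB expRN lef_pV2 ?posrE ?expR_gt0//.
  by have := expR_ge1Dx (rho - 1); rewrite addrC subrK.
apply: le_trans (ler_pM (sqr_ge0 _) (expR_ge0 _) (sqr_drift_le _ _ kj) es) _.
rewrite -/s /weight; set Q := \sum_(_ <= _ < _) _.
have Q0 : 0 <= Q.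
  by apply: sumr_ge0 => i _; rewrite mulr_ge0 ?exprn_ge0// ltW.
have us : rho^-1 ^+ (4 * s) <= u ^+ s.
  rewrite exprM lerXn2r ?nnegrE ?exprn_ge0 ?invr_ge0 ?(ltW rho0)//.
    by rewrite ltW// -(pmulr_lgt0 _ (exprn_gt0 4 rho0)) (lt_le_trans ltr01).
  by rewrite exprVn -[leLHS]mul1r ler_pdivrMr ?exprn_gt0.
have -> : 16 * M * L ^+ 2 / (1 - rho) * Q / M = 16 * L ^+ 2 / (1 - rho) * Q.
  by field; rewrite ?gt_eqF.
have -> : 16 * L ^+ 2 / (1 - rho) * rho^-1 ^+ (2 * s) * Q * rho^-1 ^+ (2 * s) =
    16 * L ^+ 2 / (1 - rho) * Q * rho^-1 ^+ (4 * s).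
  by rewrite (_ : (4 * s = 2 * s + 2 * s)%N) ?exprD -?mulnDl//; ring.
by rewrite ler_wpM2l// mulr_ge0// divr_ge0 ?mulr_ge0 ?exprn_ge0 ?ltW.
Qed.

(** Exchanging the sums leaves a geometric sum in front of each [c_i^2], hence the second factor
    [1 / (1 - rho)] in [mgf_const]. *)
Lemma sum_weight_le :
  \sum_(0 <= k < N) weight k <= mgf_const * \sum_(i < N.+1) c i ^+ 2.
Proof.
rewrite /weight -mulr_sumr.
rewrite (_ : mgf_const = 16 * M * L ^+ 2 / (1 - rho) * (1 - rho)^-1); last first.
  by rewrite /mgf_const; field; rewrite ?gt_eqF.
rewrite -[leRHS]mulrA ler_wpM2l ?divr_ge0 ?mulr_ge0 ?exprn_ge0 ?(ltW L0) ?(ltW M0) ?(ltW rho1)//.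
under eq_bigr do rewrite (big_nat_widenl _ 0)//=.
rewrite (exchange_big_dep_nat predT)//= mulr_sumr -(big_mkord predT (fun i => (1 - rho)^-1 * c i ^+ 2)).
apply: ler_sum_nat => i /andP[_ iN].
rewrite -mulr_suml ler_wpM2r ?sqr_ge0//.
apply: le_trans (geo_sum_le_before _ rho i rho01').
rewrite (big_nat_widen 0 i N)//.
Qed.

End weights.

(** * Concentration *)

Definition bdiff {X : eqType} {R : realType} {N : nat} (c : nat -> R)
    (f : N.+1.-tuple X -> R) :=
  forall z x, `|f z - f x| <=
    \sum_(i < N.+1) c i * (tnth z i != tnth x i)%:R.

Lemma bdiff_off d (X : measurableType d) (R : realType) (N : nat)
    (c : nat -> R) (f : N.+1.-tuple X -> R) (b : pred nat) z x :
  (forall i, 0 <= c i) -> bdiff c f ->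
  (forall l, (l <= N)%N -> ~~ b l -> co z l = co x l) ->
  `|f z - f x| <= \sum_(0 <= i < N.+1 | b i) c i.
Proof.
move=> c0 cf zx; apply: le_trans (cf z x) _.
rewrite [leRHS]big_mkcond big_mkord; apply: ler_sum => i _.
case: ifPn => bi.
  by rewrite ler_piMr//; case: (_ != _).
have iN : (i <= N)%N by rewrite -ltnS.
by have := zx _ iN bi; rewrite /co inord_val => ->; rewrite eqxx mulr0.
Qed.

(** * Conditional expectations at two successive visits *)

Section comparison.
Context {d : measure_display} {X : measurableType d} {R : realType} {N : nat}.
Variables (P : R.-pker X ~> X).
Local Notation Z := (N.+1.-tuple X).
Implicit Types z x : Z.

Lemma cexp_ext m k (f h : Z -> R) z : (k + m <= N)%N ->
  (forall y, (forall l, (l <= k)%N -> co y l = co z l) -> f y = h y) ->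
  cexp P m k f z = cexp P m k h z.
Proof.
elim: m k z => [|m ih] k z kmN fh; first exact: fh.
rewrite !cexpS; apply: eq_Rintegral => y _; rewrite addnS -addSn in kmN.
apply: ih => // y' yz; apply: fh => l lk.
rewrite yz ?leqW// co_upd ?ltn_eqF ?ltnS//.
by rewrite (leq_trans lk)// (leq_trans _ kmN)// (leq_trans (leqnSn k))// leq_addr.
Qed.

(** Take for [phi] the conditional expectation of [g] given [X_i]. The same [phi] serves every
    earlier time [k], so two starting times can be compared through iterates of [P]. The tuple [z0]
    only fills the other coordinates. *)
Lemma cexp_factor i (g : Z -> R) (c : R) z0 : (i <= N)%N -> bm g ->
  (forall z, `|g z| <= c) ->
  (forall z x, (forall l, (i <= l <= N)%N -> co z l = co x l) -> g z = g x) ->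
  exists phi : X -> R, [/\ bm phi, forall y : X, `|phi y| <= c &
    forall k z, (k <= i)%N ->
      cexp P (N - k) k g z = kexp P (i - k) phi (co z k)].
Proof.
move=> iN bg gc gdep.
have [mc bc] := bker_cexp (N := N) P (N - i) i.
exists (fun y : X => cexp P (N - i) i g (upd z0 i y)); split.
- by apply: bm_comp (bc _ bg) _; exact: measurable_upd.
- by move=> y; exact: (mean_norm _ (mc _)).
- move=> k z ki; have -> : (N - k = (i - k) + (N - i))%N.
    by rewrite addnC addnBA// subnK.
  rewrite cexpD subnKC// -cexp_kexp ?subnKC//.
  apply: cexp_ext; rewrite ?subnKC// => y _.
  apply: (@cexp_dep _ _ _ _ _ _ _ i) => //; rewrite ?subnKC//.
  move=> l /andP[il li]; have -> : l = i by apply/eqP; rewrite eqn_leq il li.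
  by rewrite co_upd ?eqxx.
Qed.

Variables (C : set X) (pi : probability X R) (r L : R).
Hypotheses (r01 : 0 <= r <= 1) (L0 : 0 <= L).
Hypothesis Hgeo : forall x : X, C x -> forall k : nat,
  (dTV (kiter P k x) pi <= (L * r ^+ k)%:E)%E.
Variables (c : nat -> R) (f : Z -> R).
Hypotheses (c0 : forall i, 0 <= c i) (bf : bm f) (cf : bdiff c f).

(** The coordinates between [k] and [j] cost their [c_i]. Beyond [j], [f] is telescoped coordinate
    by coordinate, and the two conditional means of each increment are compared with its mean under
    [pi]. *)
Lemma cexp_drift k j z x : (k < j)%N -> (j <= N)%N ->
  C (co z k) -> (j = N \/ C (co x j)) ->
  (forall l, (l <= k)%N -> co x l = co z l) ->
  `|cexp P (N - j) j f x - cexp P (N - k) k f z| <= drift N r L c k j.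
Proof.
move=> kj jN Cz Cx xz.
(* [F i] freezes the coordinates below [i] at those of [x]. Given the past up to [j], [f] is
   [F j.+1]; given the past up to [k], where [x] and [z] agree, it is [F k.+1]. *)
pose F i y := f (repl (fun l => (l < i)%N) x y).
have bF i : bm (F i) by apply: bm_comp bf _; exact: measurable_repl.
have kN : (k <= N)%N by rewrite (leq_trans (ltnW kj)).
have Ej : cexp P (N - j) j f x = cexp P (N - j) j (F j.+1) x.
  apply: cexp_ext; rewrite ?subnKC// => y yx; congr f; apply: co_inj => l lN.
  by rewrite co_repl//; case: ifP => //; rewrite ltnS => /yx.
have Ek : cexp P (N - k) k f z = cexp P (N - k) k (F k.+1) z.
  apply: cexp_ext; rewrite ?subnKC// => y yx; congr f; apply: co_inj => l lN.
  by rewrite co_repl//; case: ifP => //; rewrite ltnS => lk; rewrite xz// yx.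
have [mz _] := bker_cexp (N := N) P (N - k) k.
have [mx _] := bker_cexp (N := N) P (N - j) j.
have Dkj : `|cexp P (N - k) k (F j.+1) z - cexp P (N - k) k (F k.+1) z| <=
    \sum_(k.+1 <= i < j.+1) c i.
  rewrite -(meanB _ (mz z))//; apply: (mean_norm _ (mz z)); first exact: bmB.
  move=> y; rewrite (big_nat_widenl _ 0)// (big_nat_widen _ _ N.+1)//=.
  rewrite /F; apply: (bdiff_off _ _ _ _ c f) => // l lN.
  rewrite !co_repl//.
  have [lk|kl] := ltnP l k.+1; have [lj|jl] := ltnP l j.+1 => //=.
  by have := leq_trans lk (leq_trans kj (ltnW jl)); rewrite ltnn.
have tele (Lam : (Z -> R) -> R) : mean Lam -> Lam (F j.+1) =
    f x + \sum_(j.+1 <= i < N.+1) Lam (fun y => F i y - F i.+1 y).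
  move=> mL; have FN : F N.+1 = fun=> f x.
    apply/funext => y; congr f; apply: co_inj => l lN.
    by rewrite co_repl// ltnS lN.
  rewrite (eq_bigr (fun i => - (Lam (F i.+1) - Lam (F i)))); last first.
    by move=> i _; rewrite (meanB _ mL)// opprB.
  by rewrite sumrN telescope_sumr// FN (mean_cst _ mL) opprB addrC subrK.
have Dtail : `|cexp P (N - j) j (F j.+1) x - cexp P (N - k) k (F j.+1) z| <=
    \sum_(j.+1 <= i < N.+1) 4 * L * r ^+ (i - j) * c i.
  rewrite (tele _ (mx x)) (tele _ (mz z)) opprD addrACA subrr add0r -sumrB.
  apply: le_trans (ler_norm_sum _ _ _) _; apply: ler_sum_nat => i /andP[ji iN].
  (* [F i - F i.+1] is bounded by [c i] and depends only on the coordinates from [i] on, so it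
     reduces to a function [phi] of [X_i]. *)
  have [||||phi [bphi phic phiE]] := @cexp_factor i (fun y => F i y - F i.+1 y) (c i) z.
  - by rewrite -ltnS.
  - exact: bmB.
  - move=> y; apply: le_trans (bdiff_off _ _ _ _ c f (pred1 i) _ _ c0 cf _) _.
      by move=> l lN /= li; rewrite !co_repl// [(l < i)%N]ltn_neqAle li ltnS.
    rewrite big_mkcond (bigD1_seq i) ?iota_uniq ?mem_index_iota//=.
    by rewrite eqxx big1 ?addr0// => l /negbTE ->.
  - move=> y y' yy'; rewrite /F; congr (f _ - f _); apply: co_inj => l lN;
      rewrite !co_repl//; case: ifP => // /negbT; rewrite -leqNgt => il; apply: yy';
      by rewrite lN ?il// ltnW.
  rewrite !phiE ?(ltnW ji)//; last by rewrite (leq_trans (ltnW kj))// ltnW.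
  (* In the alternative [j = N] there is no index [i] beyond [j]. *)
  have Cxj : C (co x j).
    by case: Cx => // jN'; move: ji; rewrite jN' ltnNge -ltnS iN.
  have h1 := kexp_dTV _ pi _ (i - j) _ phi (c i) (c0 i) (Hgeo _ Cxj _) bphi.1 phic.
  have h2 := kexp_dTV _ pi _ (i - k) _ phi (c i) (c0 i) (Hgeo _ Cz _) bphi.1 phic.
  have rk : r ^+ (i - k) <= r ^+ (i - j).
    case/andP: r01 => r0 r1; apply: ler_wiXn2l => //.
    by rewrite leq_sub2l// ltnW.
  have {}h2 := le_trans h2 (ler_wpM2l (mulr_ge0 (ler0n R 2) (c0 i)) (ler_wpM2l L0 rk)).
  move: h1 h2; rewrite !ler_norml; lra.
rewrite Ej Ek /drift (big_cat_nat (n := j.+1)) ?ltnS ?(ltnW kj)//=.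
rewrite -(subrKA (cexp P (N - k) k (F j.+1) z)) [leRHS]addrC.
apply: le_trans (ler_normD _ _) _; apply: lerD; last first.
  apply: le_trans Dkj _; apply: ler_sum_nat => i /andP[_].
  by rewrite ltnS => ->; rewrite mul1r.
apply: le_trans Dtail _; apply: ler_sum_nat => i /andP[ji _].
by rewrite leqNgt ji.
Qed.

End comparison.

(** * Bound on the moment generating function *)

Section mgf.
Context {d : measure_display} {X : measurableType d} {R : realType} {N : nat}.
Variables (P : R.-pker X ~> X) (C : set X) (pi : probability X R).
Variables (u M r rho L : R).
Local Notation Z := (N.+1.-tuple X).
Implicit Types z x : Z.
Hypothesis mC : measurable C.
Hypotheses (L1 : 1 <= L) (M1 : 1 <= M) (rho01 : 0 < rho < 1).
Hypotheses (r_rho : 0 <= r <= rho) (u_rho : 1 <= u * rho ^+ 4).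
Hypothesis Hgeo : forall y : X, C y -> forall k : nat,
  (dTV (kiter P k y) pi <= (L * r ^+ k)%:E)%E.
Hypothesis Hvret : forall y : X, C y -> forall m,
  u * \int[P y]_y' vret P C u m y' <= M.

Section small.
Variables (c : nat -> R) (f : Z -> R).
Hypotheses (c0 : forall i, 0 <= c i) (bf : bm f) (cf : bdiff c f).
Hypothesis c_small : forall i, c i <= 2 / mgf_const M rho L.

Local Notation w := (weight N M rho L c).

(* The conditional expectation, given the coordinates up to [k], of the
   exponential of [E[f | X_0 .. X_tau]], where [tau] is the first time at or
   after [k] at which the chain is in [C], capped at [N]. *)
Fixpoint hexp m k : Z -> R :=
  if m is m'.+1 then fun z =>
    if co z k \in C then expR (cexp P m k f z) else cstep P k (hexp m' k.+1) z
  else fun z => expR (f z).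

Let bm_hexp m k : bm (hexp m k).
Proof.
elim: m k => [|m ih] k; first exact: bm_expR.
have mCk : measurable [set z : Z | C (co z k)].
  by rewrite -[X in measurable X]setTI; apply: measurable_co.
have b1 : bm (fun z => expR (cexp P m.+1 k f z)).
  by apply: bm_expR; apply: (bker_cexp P m.+1 k).2.
have b2 := (bker_cstep P k).2 _ (ih k.+1).
exact: (bm_if _ _ _ mCk b1 b2).
Qed.

Let hexp_ge0 m k z : 0 <= hexp m k z.
Proof.
elim: m k z => [|m ih] k z /=; first exact: expR_ge0.
case: ifP => _; first exact: expR_ge0.
have mk := (bker_cstep P k).1 z.
by rewrite -[leLHS](mean_cst _ mk); apply: (mean_le _ mk) => //; exact: bm_cst.
Qed.

(** The bound is affine in the martingale [cexp] and in [vret], so averaging over one step preserves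
    its form. *)
Let cstep_hexp_le m j x (G W : R) :
  (forall y, hexp m j.+1 (upd x j.+1 y) <= expR G *
    (1 + (cexp P m j.+1 f (upd x j.+1 y) - G) + W * vret P C u m y)) ->
  cstep P j (hexp m j.+1) x <= expR G * (1 + (cexp P m.+1 j f x - G) +
    W * \int[P (co x j)]_y vret P C u m y).
Proof.
move=> H; have mP := mean_ker P (co x j).
have bh : bm (fun y => hexp m j.+1 (upd x j.+1 y)).
  by apply: bm_comp (bm_hexp _ _) _; exact: measurable_upd.
have bg : bm (fun y => cexp P m j.+1 f (upd x j.+1 y)).
  by apply: bm_comp ((bker_cexp P m j.+1).2 _ bf) _; exact: measurable_upd.
have bv := bm_vret P C mC u m.
have bW := bmZ W _ bv; have bgG := bmB _ _ bg (bm_cst G).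
have b1 := bmD _ _ (bm_cst 1) bgG.
have := mean_le _ mP _ _ bh (bmZ (expR G) _ (bmD _ _ b1 bW)) H.
rewrite (meanZ _ mP _ _ (bmD _ _ b1 bW)) (meanD _ mP _ _ b1 bW).
by rewrite (meanD _ mP _ _ (bm_cst 1) bgG) (meanB _ mP) ?(meanZ _ mP) ?(mean_cst _ mP)//; exact: bm_cst.
Qed.

(** The conditional exponential is followed along an excursion, [k] being the last visit. The term
    linear in the increment is kept exact, so that it cancels on averaging from [k]; only the
    quadratic remainder is bounded. *)
Let hexp_le k m j z x : (k < j)%N -> (j + m = N)%N -> C (co z k) ->
  (forall l, (l <= k)%N -> co x l = co z l) ->
  hexp m j x <= expR (cexp P (N - k) k f z) *
    (1 + (cexp P m j f x - cexp P (N - k) k f z)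
     + w k / M * u ^+ (j - k) * vret P C u m (co x j)).
Proof.
set G := cexp P (N - k) k f z.
have w0 : 0 <= w k / M by rewrite divr_ge0 ?weight_ge0// (le_trans ler01).
(* End of the excursion, at a visit or at time [N]: there [vret] is 1, and [cexp_drift],
   [expR_le_quadratic] and [drift_weight] give the bound. *)
have stop m' j' y : (k < j')%N -> (j' + m' = N)%N -> C (co z k) ->
    (j' = N \/ C (co y j')) -> (forall l, (l <= k)%N -> co y l = co z l) ->
    expR (cexp P m' j' f y) <=
    expR G * (1 + (cexp P m' j' f y - G) + w k / M * u ^+ (j' - k) * 1).
  move=> kj jmN Cz Cy yz.
  have jN : (j' <= N)%N by rewrite -jmN leq_addr.
  have L0 : 0 <= L by rewrite (le_trans ler01).
  have r01 : 0 <= r <= 1.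
    by move: r_rho rho01 => /andP[-> /le_trans h] /andP[_ /ltW /h].
  have := cexp_drift P C pi r L r01 L0 Hgeo c f c0 bf cf k j' z y kj jN Cz Cy yz.
  have -> : (N - j' = m')%N by rewrite -jmN addKn.
  rewrite -/G; set g := cexp P m' j' f y; set D := drift _ _ _ _ _ _ => gD.
  rewrite -[X in expR X](subrK G g) expRD mulrC ler_wpM2l ?expR_ge0// mulr1.
  apply: le_trans (expR_le_quadratic _ _) _; rewrite lerD2l.
  apply: le_trans (drift_weight N u M r rho L c L1 M1 rho01 r_rho u_rho c0 c_small k j' kj jN).
  apply: ler_pM; [exact: sqr_ge0|exact: expR_ge0| |by rewrite ler_expR].
  by rewrite -[(g - G) ^+ 2]real_normK ?num_real// lerXn2r ?nnegrE// (le_trans _ gD).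
elim: m j x => [|m ih] j x kj jmN Cz xz.
  by rewrite addn0 in jmN; apply: (stop 0%N) => //; [rewrite addn0|left].
rewrite /=; case: ifPn => xC.
  by apply: (stop m.+1) => //; right; rewrite inE in xC.
have jN : (j < N)%N by rewrite -jmN -addSnnS leq_addr.
have agree y l : (l <= k)%N -> co (upd x j.+1 y) l = co z l.
  move=> lk; have lj : (l < j.+1)%N by rewrite ltnS (leq_trans lk)// ltnW.
  by rewrite co_upd ?(ltn_eqF lj) ?xz// (leq_trans _ jN)// ltnW.
(* Off [C], the factor [u] in the recursion of [vret] accounts for the excursion lasting one step
   more. *)
have -> : w k / M * u ^+ (j - k) * (u * \int[P (co x j)]_y vret P C u m y) =
    w k / M * u ^+ (j.+1 - k) * \int[P (co x j)]_y vret P C u m y.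
  by rewrite subSn ?(ltnW kj)// exprS; ring.
apply: cstep_hexp_le => y.
have := ih j.+1 (upd x j.+1 y) (leqW kj) _ Cz (agree y).
by rewrite addSnnS co_upd// eqxx; exact.
Qed.

(** Averaged from [k], the linear term vanishes; [Hvret] bounds the remainder by [w k], and
    [1 + w k <= exp (w k)]. *)
Let hexp_step k m z : (k + m.+1 = N)%N -> C (co z k) ->
  cstep P k (hexp m k.+1) z <= expR (cexp P m.+1 k f z + w k).
Proof.
move=> kmN Cz; have kN : (k < N)%N by rewrite -kmN -addSnnS leq_addr.
have w0 : 0 <= w k by exact: weight_ge0.
have M0 : 0 < M by rewrite (lt_le_trans ltr01).
set G := cexp P m.+1 k f z.
apply: le_trans (cstep_hexp_le m k z G (w k / M * u) _) _ => [y|].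
  have := hexp_le k m k.+1 z (upd z k.+1 y) (ltnSn k) _ Cz _.
  have -> : (N - k = m.+1)%N by rewrite -kmN addKn.
  rewrite -/G subSnn expr1 co_upd// eqxx; apply; first by rewrite addSnnS.
  move=> l lk; rewrite co_upd ?ltn_eqF//.
  by rewrite (leq_trans lk)// ltnW.
rewrite subrr addr0 expRD ler_wpM2l ?expR_ge0//.
apply: le_trans (expR_ge1Dx _); rewrite lerD2l -mulrA.
rewrite -[leRHS](divfK (lt0r_neq0 M0)) ler_wpM2l ?divr_ge0 ?(ltW M0)//.
exact: Hvret.
Qed.

(** Backward induction on time. At a visit to [C], [hexp_step] closes the excursion at the price
    [w k]; off [C], [hexp] is just averaged and the nonnegative [w k] only weakens the bound. *)
Let cexp_expR_le m k z : (k + m = N)%N ->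
  cexp P m k (fun y => expR (f y)) z <=
  expR (\sum_(k <= l < N) w l) * hexp m k z.
Proof.
elim: m k z => [|m ih] k z kmN.
  rewrite addn0 in kmN; rewrite kmN big_geq// expR0 mul1r//.
have kN : (k < N)%N by rewrite -kmN -addSnnS leq_addr.
have mk := (bker_cstep P k).1 z.
have bE : bm (cexp P m k.+1 (fun y => expR (f y))).
  by apply: (bker_cexp P m k.+1).2; exact: bm_expR.
have h : cexp P m.+1 k (fun y => expR (f y)) z <=
    expR (\sum_(k.+1 <= l < N) w l) * cstep P k (hexp m k.+1) z.
  rewrite -(meanZ _ mk)//; apply: (mean_le _ mk) => //; first exact: bmZ.
  by move=> y; apply: ih; rewrite addSnnS.
apply: le_trans h _; rewrite [in leRHS]big_ltn//; have [zC|zC] := boolP (co z k \in C).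
  have -> : hexp m.+1 k z = expR (cexp P m.+1 k f z) by rewrite /= zC.
  rewrite [w k + _]addrC expRD -[leRHS]mulrA ler_wpM2l ?expR_ge0//.
  by rewrite mulrC -expRD; apply: hexp_step => //; rewrite inE in zC.
have -> : hexp m.+1 k z = cstep P k (hexp m k.+1) z by rewrite /= (negbTE zC).
rewrite ler_wpM2r//; last by rewrite ler_expR lerDr weight_ge0.
by have := hexp_ge0 m.+1 k z; rewrite /= (negbTE zC).
Qed.

Lemma mgf_small z : C (co z 0) ->
  cexp P N 0 (fun y => expR (f y)) z <=
  expR (cexp P N 0 f z + mgf_const M rho L * \sum_(i < N.+1) c i ^+ 2).
Proof.
move=> Cz; apply: le_trans (cexp_expR_le _ _ _ (add0n N)) _.
have -> : hexp N 0 z = expR (cexp P N 0 f z).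
  suff H m : hexp m 0 z = expR (cexp P m 0 f z) by exact: H.
  by case: m => [|m] //=; rewrite mem_set.
rewrite -expRD ler_expR addrC lerD2l.
exact: sum_weight_le.
Qed.

End small.

(** Freezing the large coordinates at those of [z] moves [f] by at most [S]. This is paid twice, in
    the exponential and in the mean, and [2 c_i <= A c_i^2] as soon as [c_i >= 2 / A], which
    dictates the threshold. *)
Lemma mgf_bound (c : nat -> R) (f : Z -> R) z : (forall i, 0 <= c i) -> bm f ->
  bdiff c f -> C (co z 0) ->
  cexp P N 0 (fun y => expR (f y)) z <=
  expR (cexp P N 0 f z + mgf_const M rho L * \sum_(i < N.+1) c i ^+ 2).
Proof.
move=> c0 bf cf Cz.
have A0 : 0 < mgf_const M rho L.
  rewrite /mgf_const; move: rho01 => /andP[_]; rewrite -subr_gt0 => ?.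
  by rewrite divr_gt0 ?mulr_gt0 ?exprn_gt0// (lt_le_trans ltr01).
set A := mgf_const M rho L in A0 *.
pose b i := 2 / A < c i; pose c' i := if b i then 0 else c i.
pose f' y := f (repl b z y).
have c'0 i : 0 <= c' i by rewrite /c'; case: ifP.
have c'small i : c' i <= 2 / A.
  by rewrite /c'; case: ifPn => [_|]; [rewrite divr_ge0// ltW|rewrite /b -leNgt].
have bf' : bm f' by apply: bm_comp bf _; exact: measurable_repl.
have cf' : bdiff c' f'.
  move=> y y'; apply: le_trans (cf _ _) _; apply: ler_sum => i _.
  rewrite !tnth_mktuple /c'; case: ifP => // _.
  by rewrite eqxx mulr0 mul0r.
have h := mgf_small c' f' c'0 bf' cf' c'small z Cz.
set S := \sum_(0 <= i < N.+1 | b i) c i.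
have ff' y : `|f y - f' y| <= S.
  apply: (bdiff_off _ _ _ _ c f) => // l lN bl.
  by rewrite co_repl// (negbTE bl).
have mz := (bker_cexp P N 0).1 z.
have h1 : cexp P N 0 (fun y => expR (f y)) z <=
    expR S * cexp P N 0 (fun y => expR (f' y)) z.
  rewrite -(meanZ _ mz); last exact: bm_expR.
  apply: (mean_le _ mz) => [||y]; [exact: bm_expR|exact/bmZ/bm_expR|].
  by rewrite -expRD ler_expR; have := ff' y; rewrite ler_norml => /andP[]; lra.
have h2 : cexp P N 0 f' z <= cexp P N 0 f z + S.
  rewrite -[X in _ + X](mean_cst _ mz) -(meanD _ mz)//; last exact: bm_cst.
  apply: (mean_le _ mz) => [//||y]; first by apply: bmD => //; exact: bm_cst.
  by have := ff' y; rewrite ler_norml => /andP[]; lra.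
have h3 : S + S + A * \sum_(i < N.+1) c' i ^+ 2 <= A * \sum_(i < N.+1) c i ^+ 2.
  rewrite /S big_mkcond big_mkord !mulr_sumr -!big_split/=; apply: ler_sum => i _.
  rewrite /c'; case: ifPn => [|_]; last by rewrite !add0r.
  rewrite /b ltr_pdivrMr// => bi; rewrite expr0n/= mulr0 addr0.
  by have := ler_wpM2l (c0 i) (ltW bi); lra.
apply: le_trans h1 _; apply: le_trans (ler_wpM2l (expR_ge0 S) h) _.
by rewrite -/A -expRD ler_expR; move: h2 h3; lra.
Qed.
End mgf.

(** * Chernoff's bound and conclusion *)

Lemma bdiff_bm d (X : measurableType d) (R : realType) (N : nat)
    (c : nat -> R) (f : N.+1.-tuple X -> R) (z0 : N.+1.-tuple X) : (forall i, 0 <= c i) ->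
  measurable_fun [set: N.+1.-tuple X] f -> bdiff c f -> bm f.
Proof.
move=> c0 mf cf; split=> //; exists (\sum_(i < N.+1) c i + `|f z0|) => z.
rewrite -[f z](subrK (f z0)) (le_trans (ler_normD _ _))// lerD2r.
apply: le_trans (cf _ _) _; apply: ler_sum => i _.
by rewrite ler_piMr//; case: (_ != _).
Qed.

Lemma chernoff_subgaussian d (T : measurableType d) (R : realType)
    (Pr : probability T R) (F : T -> R) (E K t : R) :
  bm F -> 0 < K -> 0 < t ->
  (forall s, 0 < s -> \int[Pr]_w expR (s * F w) <= expR (s * E + K * s ^+ 2)) ->
  (Pr [set w | (t < F w - E)%R] <= (expR (- (t ^+ 2 / (4 * K))))%:E)%E.
Proof.
move=> bF K0 t0 H; set A := [set w | _].
have mPr := mean_Rintegral _ (probability_setT Pr).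
have mA : measurable A.
  rewrite -[A]setTI; apply: measurable_fun_ltr => //.
  exact: (bmB _ _ bF (bm_cst E)).1.
rewrite prob_Rintegral// lee_fin.
(* This [s] minimises [K s^2 - s t], with minimum [- t^2 / (4 K)]. *)
pose s := t / (2 * K).
have s0 : 0 < s by rewrite divr_gt0// mulr_gt0.
have bE : bm (fun w => expR (s * F w)) by exact/bm_expR/bmZ.
apply: le_trans (_ : _ <= \int[Pr]_w (expR (- (s * (E + t))) * expR (s * F w))) _.
  apply: (mean_le _ mPr) => [||w]; [exact: bm_indic|exact: bmZ|].
  rewrite indicE; have [|_] := boolP (w \in A); last by rewrite mulr_ge0 ?expR_ge0.
  rewrite inE /A/= => tF; rewrite -expRD -[leLHS]expR0 ler_expR.
  by rewrite -mulrN -mulrDr mulr_ge0 ?(ltW s0)//; lra.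
rewrite (meanZ _ mPr)//.
apply: le_trans (ler_wpM2l (expR_ge0 _) (H _ s0)) _.
rewrite -expRD ler_expR le_eqVlt; apply/orP; left; apply/eqP.
by rewrite /s; field; rewrite gt_eqF.
Qed.

Local Open Scope ereal_scope.

Theorem theorem1 (d : measure_display) (X : measurableType d) (R : realType)
  (P : R.-pker X ~> X)
  (dO : measure_display) (O : measurableType dO)
  (Px : X -> probability O R) (Xs : nat -> O -> X)
  (Hchain : forall x, markov_chain P (Px x) Xs x)
  (pi : probability X R)
  (Hirr : irreducible P Px Xs) (Hap : aperiodic P Px Xs)
  (Hinv : invariant_prob P pi)
  (Huniq : forall pi' : probability X R, invariant_prob P pi' ->
             forall A, measurable A -> pi' A = pi A)
  (C : set X) (u M : R) (mC : measurable C) (C0 : C !=set0)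
  (hu : (1 < u)%R) (hM : (0 < M)%R)
  (Hret : forall x, C x -> \int[Px x]_w pow_sigma u Xs C w <= M%:E)
  (r L : R) (hr0 : (0 < r)%R) (hr1 : (r < 1)%R) (hL : (1 <= L)%R)
  (Hgeo : forall x, C x -> forall k : nat,
            dTV (kiter P k x) pi <= (L * r ^+ k)%:E)
  (n : nat) (hn : (0 < n)%N) (c : 'I_n -> R) (hc : forall i, (0 <= c i)%R)
  (f : n.-tuple X -> R) (mf : measurable_fun [set: n.-tuple X] f)
  (hf : forall x y : n.-tuple X,
          (`|f x - f y| <= \sum_(i < n) c i * (tnth x i != tnth y i)%:R)%R)
  (x : X) (hx : C x) (t : R) (ht : (0 < t)%R) :
  Px x [set w | 'E_(Px x)[fun w' => f [tuple Xs i w' | i < n]]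
                  < (f [tuple Xs i w | i < n] - t)%:E]
    <= (expR (- (beta_const u M r L * t ^+ 2 / \sum_(i < n) c i ^+ 2)))%:E.
Proof.
case: n hn c hc f mf hf => // N _ c hc f mf hf.
pose v := (u `^ (- 4^-1))%R; pose rho := Num.max r v.
have u0 : (0 < u)%R by rewrite (lt_trans ltr01).
have v0 : (0 < v)%R by rewrite powR_gt0.
have v4 : (v ^+ 4 = u^-1)%R.
  rewrite -powR_mulrn ?(ltW v0)// -powRrM mulNr mulVf// powR_inv1//.
  exact: ltW.
have v1 : (v < 1)%R by rewrite -(@expr_lt1 _ 4)// ?(ltW v0)// v4 invf_lt1.
have rho01 : (0 < rho < 1)%R by rewrite lt_max hr0 gt_max hr1 v1.
have r_rho : (0 <= r <= rho)%R by rewrite (ltW hr0) le_max lexx.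
have u_rho : (1 <= u * rho ^+ 4)%R.
  rewrite -[leLHS](divff (lt0r_neq0 u0)) -v4 ler_pM2l//.
  by rewrite lerXn2r ?nnegrE ?(ltW v0)// ?le_max ?lexx ?orbT// ltW//; case/andP: rho01.
have Hvret (y : X) : C y -> forall m, (u * \int[P y]_z vret P C u m z <= M)%R.
  by move=> Cy m; exact: (vret_le P C mC u (Px y) Xs y M (Hchain y) hu (Hret _ Cy)).
(* At depth 0, [vret] is 1 and [Hvret] reads [u <= M]. *)
have M1 : (1 <= M)%R.
  apply: le_trans (Hvret x hx 0%N); rewrite /= (mean_cst _ (mean_ker P x)) mulr1.
  exact: ltW.
pose c' k := c (inord k).
have c'0 k : (0 <= c' k)%R by exact: hc.
have c'E (g : R -> R) : (\sum_(i < N.+1) g (c' i) = \sum_(i < N.+1) g (c i))%R.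
  by apply: eq_bigr => i _; rewrite /c' inord_val.
have cf : bdiff c' f.
  move=> y z; apply: le_trans (hf y z) _; apply: ler_sum => i _.
  by rewrite /c' inord_val.
pose z0 : N.+1.-tuple X := [tuple x | i < N.+1].
have z0x : co z0 0 = x by rewrite /co tnth_mktuple.
have bf : bm f by exact: bdiff_bm z0 c'0 mf cf.
pose F w := f (traj Xs w).
have mt := @measurable_traj _ _ _ N _ _ P (Px x) Xs x (Hchain x).
have bF : bm F by exact: bm_comp bf mt.
pose E := (\int[Px x]_w F w)%R.
have EE : 'E_(Px x)[F] = E%:E.
  rewrite unlock /E fineK//; apply: integrable_fin_num => //.
  by apply: bm_integrable => //; exact: probability_setT.
set A := mgf_const M rho L.
have rho1 : (0 < 1 - rho)%R by rewrite subr_gt0; case/andP: rho01.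
have L0 : (0 < L)%R by rewrite (lt_le_trans ltr01).
have A0 : (0 < A)%R by rewrite /A /mgf_const divr_gt0 ?mulr_gt0 ?exprn_gt0.
have -> : [set w | 'E_(Px x)[fun w' => f [tuple Xs i w' | i < N.+1]]
    < (f [tuple Xs i w | i < N.+1] - t)%:E] = [set w | (t < F w - E)%R].
  apply/seteqP; split => w /=; rewrite [expectation _ _]EE lte_fin /F /traj; lra.
(* If all [c_i] vanish, the quotient is 0 by the convention on inverses and the claimed bound is
   1. *)
have [S0|S0] := eqVneq (\sum_(i < N.+1) c i ^+ 2)%R 0%R.
  rewrite S0 invr0 mulr0 oppr0 expR0 probability_le1//.
  rewrite -[X in measurable X]setTI; apply: measurable_fun_ltr => //.
  exact: (bmB _ _ bF (bm_cst E)).1.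
have {}S0 : (0 < \sum_(i < N.+1) c i ^+ 2)%R.
  by rewrite lt_def S0 sumr_ge0// => i _; exact: sqr_ge0.
apply: le_trans (_ : _ <= (expR (- (t ^+ 2 /
    (4 * (A * \sum_(i < N.+1) c i ^+ 2)))))%:E) _.
  (* For each [s], [mgf_bound] is applied to [s f], whose differences are bounded by the [s c_i]. *)
  apply: chernoff_subgaussian => //; first exact: mulr_gt0.
  move=> s s0; have bsf : bm (fun z => s * f z)%R by exact: bmZ.
  have csf : bdiff (fun i => s * c' i)%R (fun z => s * f z)%R.
    move=> y z; rewrite -mulrBr normrM gtr0_norm//.
    apply: le_trans (ler_wpM2l (ltW s0) (cf y z)) _.
    by rewrite mulr_sumr; apply: ler_sum => i _; rewrite mulrA.
  have := mgf_bound P C pi u M r rho L mC hL M1 rho01 r_rho u_rho Hgeo Hvret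
    (fun i => s * c' i)%R (fun z => s * f z)%R z0 (fun i => mulr_ge0 (ltW s0) (c'0 i))
    bsf csf.
  rewrite z0x => /(_ hx).
  rewrite -(traj_cexp P (Px x) Xs x (Hchain x) _ z0 (bm_expR _ bsf) z0x).
  rewrite -(traj_cexp P (Px x) Xs x (Hchain x) _ z0 bsf z0x).
  rewrite (meanZ _ (mean_Rintegral _ (probability_setT (Px x))) s _ bF).
  under eq_bigr do rewrite exprMn.
  by rewrite -mulr_sumr (c'E (fun y => y ^+ 2)%R) -/A [in (s ^+ 2 * _)%R]mulrC mulrA.
(* [1 / (4 A)] is [beta] with the nonnegative term [5 / ln u] removed from the factor that is
   inverted. *)
have hb : (beta_const u M r L <= (4 * A)^-1)%R.
  rewrite /beta_const -/v -/rho.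
  have -> : ((4 * A)^-1 = (1 - rho) ^+ 2 / (16 * L) * (4 * M * L)^-1)%R.
    by rewrite /A /mgf_const; field; rewrite ?gt_eqF.
  have ML0 : (0 < 4 * M * L)%R by rewrite !mulr_gt0.
  have lnu : (0 <= 5 / ln u)%R by rewrite divr_ge0// ltW// ln_gt0.
  rewrite ler_wpM2l ?divr_ge0 ?mulr_ge0 ?exprn_ge0 ?(ltW L0) ?(ltW rho1)//.
  by rewrite lef_pV2 ?posrE// ?ltr_wpDl// lerDr.
rewrite lee_fin ler_expR lerN2.
have -> : (t ^+ 2 / (4 * (A * \sum_(i < N.+1) c i ^+ 2)) =
    (4 * A)^-1 * t ^+ 2 / \sum_(i < N.+1) c i ^+ 2)%R.
  by field; rewrite ?gt_eqF.
by rewrite ler_wpM2r ?invr_ge0 ?(ltW S0)// ler_wpM2r ?sqr_ge0.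
Qed.
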